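(* Let $\kappa$ be an infinite cardinal and $\alpha<\kappa^+$ a non-zero ordinal. There is a family $\mathcal F\subseteq\mathbf A_\kappa^\alpha(\mathcal C^e)$ such that: (1) for every $G\in\mathbf A_\kappa^\alpha(\mathcal C^e)$ and every finite subgraph $K\subseteq G$ there are $H\in\mathcal F$ and a strong immersion $\Phi:G\to H$ such that, if there is no open ear of $K$ in $G$, then there is no open ear of $\Phi[K]$ in $H$; (2) $|\mathcal F|\leq\kappa$. Consequently $\mathrm{Stc}(\mathbf A_\kappa(\mathcal C^e))=\kappa^+$.
   Context: All graphs are simple and undirected. An immersion of $G$ into $H$ is an injective map $\phi:V(G)\to V(H)$ with $uv\in E(G)\Rightarrow\phi(u)\phi(v)\in E(H)$; it is strong if moreover $uv\in E(G)\iff\phi(u)\phi(v)\in E(H)$; $\Phi[K]$ denotes the image of the subgraph $K$. For a class $\mathcal D$, a family $\mathcal F\subseteq\mathcal D$ is strongly universal if every member of $\mathcal D$ strongly immerses into some member of $\mathcal F$; $\mathrm{Stc}(\mathcal D)$ is the minimal cardinality of such a family. Rank: a graph has rank $0$ iff finite; for $\alpha>0$, $G$ has rank $\alpha$ iff it has no smaller rank and there is a finite subgraph $F$ such that every component of $G-F$ has rank $<\alpha$; rayless graphs (no one-way infinite path) are exactly those with a rank. A $\kappa$-rayless graph is a connected rayless graph with at most $\kappa$ vertices. $\mathcal C^e$ is the family of all even cycles; $\mathbf A_\kappa(\mathcal C^e)$ is the class of $\kappa$-rayless graphs containing no even cycle, and $\mathbf A_\kappa^\alpha(\mathcal C^e)$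 its subclass of graphs of rank $<\alpha$. Given a graph $G$ and a subgraph $H\subseteq G$, an open ear of $H$ in $G$ is a path $P\subseteq G$ (with at least one edge) whose only vertices in $H$ are its two end vertices. *)

(* Defs.v *)
From mathcomp Require Import all_boot.
From mathcomp Require Import boolp classical_sets functions cardinality.

Set Implicit Arguments.
Unset Strict Implicit.
Unset Printing Implicit Defensive.

Local Open Scope classical_set_scope.
Local Open Scope card_scope.

(** Cardinals are represented by types (or sets), compared by injections. *)

Definition card_lt (T U : Type) (A : set T) (B : set U) : Prop :=
  (A #<= B) /\ ~ (B #<= A).

Definition is_successor_cardinal (K S : Type) : Prop :=
  card_lt [set: K] [set: S] /\
  forall T : Type, card_lt [set: K] [set: T] -> [set: S] #<= [set: T].

(** An ordinal is a well-ordered type.  An element [a] of [alpha] stands for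
    the ordinal [{b | b < a}], so the elements of [alpha] are, up to order
    isomorphism, exactly the ordinals smaller than [alpha]. *)

Record ordinal_type := OrdinalType {
  ord_carrier :> Type;
  ord_lt : ord_carrier -> ord_carrier -> Prop;
  ord_lt_trans : forall a b c, ord_lt a b -> ord_lt b c -> ord_lt a c;
  ord_lt_total : forall a b, ord_lt a b \/ a = b \/ ord_lt b a;
  ord_lt_wf : well_founded ord_lt
}.

Definition ord_nonzero (alpha : ordinal_type) : Prop := exists a : alpha, True.

(** [alpha < kappa^+]: as an initial ordinal, [kappa^+] is the set of all
    ordinals of cardinality at most [kappa]. *)
Definition ord_lt_successor (alpha : ordinal_type) (K : Type) : Prop :=
  [set: alpha] #<= [set: K].

Record graph := Graph {
  vertex :> Type;
  adj : vertex -> vertex -> Prop;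
  adj_sym : forall u v, adj u v -> adj v u;
  adj_irrefl : forall u, ~ adj u u
}.

Record immersion (G H : graph) := Immersion {
  im_fun :> G -> H;
  im_inj : injective im_fun;
  im_adj : forall u v, adj u v -> adj (im_fun u) (im_fun v)
}.

Record strong_immersion (G H : graph) := StrongImmersion {
  sim_immersion :> immersion G H;
  sim_adj : forall u v, adj u v <-> adj (sim_immersion u) (sim_immersion v)
}.

Section Subgraphs.
Variable G : graph.

Record subgraph := Subgraph {
  sg_vertex : set G;
  sg_edge : G -> G -> Prop;
  sg_edge_sym : forall u v, sg_edge u v -> sg_edge v u;
  sg_edge_adj : forall u v, sg_edge u v -> adj u v;
  sg_edge_vertex : forall u v, sg_edge u v -> sg_vertex u
}.

Definition finite_subgraph (K : subgraph) : Prop := finite_set (sg_vertex K).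

(* [{x | A x}] here and [{i | i < n}] below, because MathComp's [set_type] and
   ['I_n] live in too large a universe for [set graph] to be formed. *)
Lemma induced_adj_sym (A : set G) (u v : {x | A x}) :
  adj (sval u) (sval v) -> adj (sval v) (sval u).
Proof. exact: adj_sym. Qed.

Lemma induced_adj_irrefl (A : set G) (u : {x | A x}) : ~ adj (sval u) (sval u).
Proof. exact: adj_irrefl. Qed.

Definition induced (A : set G) : graph :=
  Graph (@induced_adj_sym A) (@induced_adj_irrefl A).

Definition delete (F : subgraph) : graph := induced (~` sg_vertex F).

(** The path [p 0, ..., p n] with [n] edges; the other values of [p] are
    irrelevant. *)
Definition is_path (n : nat) (p : nat -> G) : Prop :=
  (forall i j, i <= n -> j <= n -> p i = p j -> i = j) /\
  (forall i, i < n -> adj (p i) (p i.+1)).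

Definition joined (x y : G) : Prop :=
  exists n p, [/\ is_path n p, p 0 = x & p n = y].

Definition connected : Prop :=
  (exists x : G, True) /\ forall x y : G, joined x y.

Definition is_component (C : set G) : Prop :=
  exists x, C = [set y | joined x y].

Definition rayless : Prop :=
  ~ exists r : nat -> G, injective r /\ forall i, adj (r i) (r i.+1).

(** The path meets [K], as a graph, exactly in its two ends: for [n = 1] the
    last clause says that an edge of [K] is not an ear of [K]; for [n > 1] it
    follows from the previous one. *)
Definition is_open_ear (K : subgraph) (n : nat) (p : nat -> G) : Prop :=
  [/\ 0 < n, is_path n p,
      sg_vertex K (p 0) /\ sg_vertex K (p n),
      forall i, 0 < i -> i < n -> ~ sg_vertex K (p i)
    & forall i, i < n -> ~ sg_edge K (p i) (p i.+1)].

Definition has_open_ear (K : subgraph) : Prop :=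
  exists n p, is_open_ear K n p.

End Subgraphs.

Section Image.
Variables (G H : graph) (phi : immersion G H) (K : subgraph G).

Definition im_edge (x y : H) : Prop :=
  exists u v, [/\ sg_edge K u v, phi u = x & phi v = y].

Lemma im_edge_sym x y : im_edge x y -> im_edge y x.
Proof. by move=> [u [v [uv <- <-]]]; exists v, u; split=> //; apply: sg_edge_sym. Qed.

Lemma im_edge_adj x y : im_edge x y -> adj x y.
Proof. by move=> [u [v [uv <- <-]]]; apply: im_adj; apply: sg_edge_adj uv. Qed.

Lemma im_edge_vertex x y : im_edge x y -> (phi @` sg_vertex K) x.
Proof. by move=> [u [v [uv <- _]]]; exists u => //; apply: sg_edge_vertex uv. Qed.

Definition image_subgraph : subgraph H :=
  Subgraph im_edge_sym im_edge_adj im_edge_vertex.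

End Image.

(** [has_rank a G]: the rank of [G] is the ordinal represented by [a].
    The recursion equation is [has_rankE] below. *)

Section Rank.
Variable alpha : ordinal_type.

Definition rank_step (a : alpha)
    (rec : forall b : alpha, ord_lt b a -> graph -> Prop) (G : graph) : Prop :=
  ((forall b : alpha, ~ ord_lt b a) /\ finite_set [set: G]) \/
  [/\ exists b : alpha, ord_lt b a,
      ~ (exists b (ba : ord_lt b a), rec b ba G)
    & exists F : subgraph G, finite_subgraph F /\
        forall C : set (delete F), is_component C ->
          exists b (ba : ord_lt b a), rec b ba (induced C)].

Definition has_rank : alpha -> graph -> Prop :=
  Fix (@ord_lt_wf alpha) (fun _ => graph -> Prop) rank_step.

Lemma has_rankE (a : alpha) (G : graph) :
  has_rank a G <->
  ((forall b : alpha, ~ ord_lt b a) /\ finite_set [set: G]) \/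
  [/\ exists b : alpha, ord_lt b a,
      ~ (exists b : alpha, ord_lt b a /\ has_rank b G)
    & exists F : subgraph G, finite_subgraph F /\
        forall C : set (delete F), is_component C ->
          exists b : alpha, ord_lt b a /\ has_rank b (induced C)].
Proof.
rewrite {1}/has_rank Fix_eq; last first.
  move=> x f g fg; congr rank_step.
  by apply: functional_extensionality_dep => b;
     apply: functional_extensionality_dep => ba.
have E (X : graph) : (exists (b : alpha) (_ : ord_lt b a), has_rank b X) <->
    (exists b : alpha, ord_lt b a /\ has_rank b X).
  by split=> [[c [ca h]]|[c [ca h]]]; exists c; [split|exists ca].
split=> -[h|[h1 h2 [F [Ffin h3]]]]; [by left| |by left| ]; right; split=> //.
- by move=> /E h; apply: h2.
- by exists F; split=> // C /h3 h; apply/E.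
- by move=> h; apply: h2; apply/E.
- by exists F; split=> // C /h3 h; apply/E.
Qed.

Definition rank_lt (G : graph) : Prop := exists a : alpha, has_rank a G.

End Rank.

Section Cycles.
Variable n : nat.

Definition cycle_adj (i j : {i : nat | i < n}) : Prop :=
  i <> j /\ (sval j = (sval i).+1 %% n \/ sval i = (sval j).+1 %% n).

Lemma cycle_adj_sym i j : cycle_adj i j -> cycle_adj j i.
Proof. by move=> [ij e]; split; [move=> ji; apply: ij|case: e; [right|left]]. Qed.

Lemma cycle_adj_irrefl i : ~ cycle_adj i i.
Proof. by case. Qed.

Definition cycle_graph : graph := Graph cycle_adj_sym cycle_adj_irrefl.

End Cycles.

Definition even_cycles : set graph :=
  [set C | exists n, [/\ 3 <= n, ~~ odd n & C = cycle_graph n]].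

Definition kappa_rayless (K : Type) (G : graph) : Prop :=
  [/\ connected G, rayless G & [set: G] #<= [set: K]].

(** [avoiding K X] is the class A_kappa(X) for [kappa] the cardinality of [K];
    containment means containment as a (not necessarily induced) subgraph. *)
Definition avoiding (K : Type) (X : set graph) : set graph :=
  [set G | kappa_rayless K G /\ forall C, X C -> ~ inhabited (immersion C G)].

Definition avoiding_rank (K : Type) (alpha : ordinal_type) (X : set graph) :
  set graph := [set G | avoiding K X G /\ rank_lt alpha G].

Definition strongly_universal (D F : set graph) : Prop :=
  F `<=` D /\
  forall G, D G -> exists H, F H /\ inhabited (strong_immersion G H).

(** Stc(D) is the cardinality of [S]. *)
Definition is_Stc (D : set graph) (S : Type) : Prop :=
  (exists F, strongly_universal D F /\ F #= [set: S]) /\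
  forall F, strongly_universal D F -> [set: S] #<= F.

(* Main.v *)
Require Import Defs.
From mathcomp Require Import all_boot.
From mathcomp Require Import boolp classical_sets functions cardinality.
From mathcomp Require wochoice.
From mathcomp Require Import zify.
From Stdlib Require Import Relation_Operators Wellfounded.

(** A connected graph without even cycles is a cactus whose blocks are edges and odd
    cycles; if it is moreover rayless, then cutting it at a root and recursing into the
    pieces is well-founded and presents it as an inductive tree of blocks. In a tree of
    blocks the rank is visible: it is at most [a] iff, recursively, all but finitely many
    blocks at each vertex carry trees of rank [< a], and those at the exceptional blocks
    have rank at most [a] again. So the trees of rank at most [a] embed into the finite
    trees in which every vertex is given, for each [b < a], [K] copies of each block of
    universal trees of rank [b]; there are at most [K] such trees. These embeddings map
    blocks onto whole blocks, hence a path between two vertices of the image stays in the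
    image and no open ear arises.

    For [Stc], every rayless graph on at most [K] vertices has a rank below [K^+], which
    gives a universal family of cardinality [K^+], and a diagonal argument shows that no
    family of cardinality [K] is strongly universal. *)

Set Implicit Arguments.
Unset Strict Implicit.
Unset Printing Implicit Defensive.

Local Open Scope classical_set_scope.
Local Open Scope card_scope.

(** * Cardinal arithmetic *)

(** The tree of blocks is well-founded and has only finitely many exceptional blocks at each vertex.
    By Kőnig's lemma, the vertices reached from the root through exceptional blocks alone are
    therefore finite in number, and they span a finite skeleton. Beyond the skeleton only trees of
    smaller rank occur, and enough copies of these can be attached in advance. Since there are
    countably many skeletons and at most [K] ranks, the family stays within [K]. The obstacle is
    that an odd cycle can only be mapped onto a whole odd cycle of the same length, with the trees
    at all its vertices placed at once. So the unit to be copied is not a tree of smaller rank but a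
    block together with the finite list of trees along it. This is why a skeleton also has to serve
    as a list of trees. The rank itself is awkward because it is exact and its recursion speaks of
    components. It is replaced by the notion of rank at most [a], which passes to subgraphs. *)

Definition inj_on T U (A : set T) (f : T -> U) : Prop :=
  forall x y, A x -> A y -> f x = f y -> x = y.

Lemma inj_on_card_le T U (A : set T) (B : set U) (f : T -> U) :
  inj_on A f -> (forall x, A x -> B (f x)) -> A #<= B.
Proof.
move=> fi fB; have [] : $|{injfun A >-> B}|; last by move=> g; exact: inj_card_le.
apply/injfunPex; exists f => //.
by move=> x y; rewrite !inE => Ax Ay; apply: fi.
Qed.

Lemma card_le_inj_on T U (A : set T) (B : set U) (u0 : U) :
  A #<= B -> exists f : T -> U, inj_on A f /\ forall x, A x -> B (f x).
Proof.
move=> /card_leP[g].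
have /choice[f fP] : forall x, exists y,
    forall h : x \in A, y = val (g (SigSub h)).
  move=> x; case: (pselect (x \in A)) => h; last by exists u0.
  by exists (val (g (SigSub h))) => h'; congr (val (g (SigSub _))); apply: bool_irrelevance.
exists f; split=> [x y /mem_set hx /mem_set hy|x /mem_set hx].
  rewrite (fP _ hx) (fP _ hy) => /val_inj e.
  have := @inj _ _ _ g; rewrite /= => /(_ (SigSub hx) (SigSub hy)).
  by rewrite !in_setE => /(_ I I e) [].
by rewrite (fP _ hx); apply: set_mem; apply: valP.
Qed.

(** The graph of a partial injection. *)
Definition comparison_rel T U (R : set (T * U)) : Prop :=
  forall p q, R p -> R q -> (p.1 = q.1 -> p.2 = q.2) /\ (p.2 = q.2 -> p.1 = q.1).

(** By Zorn's lemma there is a maximal partial injection from [A] to [B]. If it missed both some [a]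
    in [A] and some [b] in [B], the pair [(a, b)] could be added. *)
Lemma card_le_total T U (A : set T) (B : set U) : A #<= B \/ B #<= A.
Proof.
pose P (R : set (T * U)) := comparison_rel R /\ R `<=` (A `*` B).
have [|R [[Rc RAB] Rmax]] := @Zorn_bigcup _ P.
  move=> F FP Ftot; split; last by move=> p [X FX Xp]; have [_ h] := FP _ FX; apply: h.
  move=> p q [X FX Xp] [Y FY Yq].
  have [XY|YX] := Ftot _ _ FX FY.
    by have [h _] := FP _ FY; apply: h => //; apply: XY.
  by have [h _] := FP _ FX; apply: h => //; apply: YX.
case: (pselect (forall a, A a -> exists b, R (a, b))) => [hA|].
  left; case: (pselect (inhabited U)) => [[u0]|U0]; last first.
    suff -> : A = set0 by exact: card_ge0.
    by apply/seteqP; split=> // x /hA[b _]; apply: U0; exists.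
  have /choice[f fP] : forall a, exists b, A a -> R (a, b).
    by move=> a; case: (pselect (A a)) => [/hA[b ab]|na]; [exists b|exists u0].
  apply: (@inj_on_card_le _ _ _ _ f).
    move=> x y Ax Ay e; have [_ h] := Rc _ _ (fP _ Ax) (fP _ Ay); exact: h.
  by move=> x /fP /RAB[].
move=> /existsNP[a /not_implyP[Aa na]].
right; have hB : forall b, B b -> exists a', R (a', b).
  move=> b Bb; apply: contrapT => nb.
  apply: (Rmax (R `|` [set (a, b)])).
    split; first by move=> p; left.
    by move=> /(_ (a, b) (or_intror erefl)) h; apply: na; exists b.
  split; last by move=> p [/RAB//|->].
  move=> p q [Rp|->] [Rq|->] //=; first exact: Rc.
    split=> e; first by case: na; exists p.2; rewrite -e -surjective_pairing.
    by case: nb; exists p.1; rewrite -e -surjective_pairing.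
  split=> e; first by case: na; exists q.2; rewrite e -surjective_pairing.
  by case: nb; exists q.1; rewrite e -surjective_pairing.
have /choice[f fP] : forall b, exists a', B b -> R (a', b).
  by move=> b; case: (pselect (B b)) => [/hB[c cb]|nb]; [exists c|exists a].
apply: (@inj_on_card_le _ _ _ _ f).
  move=> x y Bx By e; have [h _] := Rc _ _ (fP _ Bx) (fP _ By); exact: h.
by move=> x /fP /RAB[].
Qed.

(** * The square of an infinite cardinal *)

Section Square.
Variable K : Type.

Let dom (R : set (K * K * K)) a := exists c, R (a, a, c).

(* [R (a, b, c)] reads "[c] codes the pair [(a, b)]". *)
Definition pairing_rel (R : set (K * K * K)) : Prop :=
  [/\ forall a b a' b' c, R (a, b, c) -> R (a', b', c) -> a = a' /\ b = b',
      forall a b c, R (a, b, c) -> [/\ dom R a, dom R b & dom R c]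
    & forall a b, dom R a -> dom R b -> exists c, R (a, b, c)].

(** Take a maximal partial pairing that extends one on a countable set, and let [A] be its domain.
    If the complement of [A] injects into [A], then all of [K] injects into [A] and inherits the
    pairing. Otherwise [A] has a disjoint copy [B], and the pairing extends to the union of [A] and
    [B] with all new codes in [B], against maximality. *)
Lemma infinite_pairing : infinite_set [set: K] ->
  exists p : K -> K -> K, forall a b c d, p a b = p c d -> a = c /\ b = d.
Proof.
move=> /infiniteP Kinf.
have [k0 _] : [set: K] !=set0 by apply: infinite_setN0; apply/infiniteP.
have [i [iinj _]] := card_le_inj_on k0 Kinf.
have {iinj}iinj m n : i m = i n -> m = n by apply: iinj.
pose R0 : set (K * K * K) :=
  [set t | exists m n, t = (i m, i n, i (pickle (m, n)))].
have dom0 n : dom R0 (i n) by exists (i (pickle (n, n))), n, n.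
have R0P : pairing_rel R0.
  split.
  - move=> a b a' b' c [m [n [-> -> ->]]] [m' [n' [-> -> /iinj e]]].
    by have [-> ->] := pcan_inj (@pickleK _) e.
  - by move=> a b c [m [n [-> -> ->]]].
  - move=> a b [c [m [n [-> _ _]]]] [c' [m' [n' [-> _ _]]]].
    by exists (i (pickle (m, m'))), m, m'.
(* The seed [R0] is adjoined to [R] instead of being required inside it, so that the empty chain is
   bounded as well. *)
have [|R [RP Rmax]] := @Zorn_bigcup _ (fun R => pairing_rel (R `|` R0)).
  move=> F FP Ftot; set U := _ `|` R0.
  have common p q : U p -> U q ->
    exists R, [/\ pairing_rel (R `|` R0), R `|` R0 `<=` U, (R `|` R0) p & (R `|` R0) q].
    have in1 X : F X -> X `|` R0 `<=` U.
      by move=> FX p' [Xp|]; [left; exists X|right].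
    move=> [[X FX Xp]|p0] [[Y FY Yq]|q0].
    - have [XY|YX] := Ftot _ _ FX FY.
        by exists Y; split; [exact: FP|exact: in1|left; exact: XY|left].
      by exists X; split; [exact: FP|exact: in1|left|left; exact: YX].
    - by exists X; split; [exact: FP|exact: in1|left|right].
    - by exists Y; split; [exact: FP|exact: in1|right|left].
    - by exists set0; split; rewrite ?set0U // => x; right.
  have domW R a : R `<=` U -> dom R a -> dom U a by move=> RU [c /RU]; exists c.
  split.
  - move=> a b a' b' c h h'; have [R [[RP _ _] _ Rp Rq]] := common _ _ h h'.
    exact: RP Rp Rq.
  - move=> a b c h; have [R [[_ RP _] RU Rp _]] := common _ _ h h.
    by have [] := RP _ _ _ Rp; split; apply: domW; eauto.
  - move=> a b [c h] [c' h']; have [R [[_ _ RP] RU Rp Rq]] := common _ _ h h'.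
    have [||d Rd] := RP a b; [by exists c|by exists c'|].
    by exists d; apply: RU.
set M := R `|` R0 in RP; pose A := dom M.
have [Minj Mdom Mtot] := RP.
have Ai n : A (i n) by have [c ?] := dom0 n; exists c; right.
have /choice[f0 f0P] : forall ab : K * K, exists c, A ab.1 -> A ab.2 -> M (ab, c).
  move=> [a b]; case: (pselect (A a /\ A b)) => [[Aa Ab]|nab].
    by have [c ?] := Mtot _ _ Aa Ab; exists c.
  by exists k0 => Aa Ab; case: nab.
pose f a b := f0 (a, b).
have fM a b : A a -> A b -> M (a, b, f a b) by move=> Aa Ab; exact: (f0P (a, b)).
have fA a b : A a -> A b -> A (f a b) by move=> Aa Ab; have [] := Mdom _ _ _ (fM _ _ Aa Ab).
have finj a b c d : A a -> A b -> A c -> A d -> f a b = f c d -> a = c /\ b = d.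
  by move=> Aa Ab Ac Ad e; apply: (Minj _ _ _ _ (f a b)); [|rewrite e]; apply: fM.
have [CA|AC] := card_le_total (~` A) A.
  have [h [hi hA]] := card_le_inj_on k0 CA.
  pose e x := if pselect (A x) then f x (i 0) else f (h x) (i 1).
  have eA x : A (e x).
    by rewrite /e; case: pselect => Ax; apply: fA => //; apply: hA.
  have ei x y : e x = e y -> x = y.
    rewrite /e; case: pselect => Ax; case: pselect => Ay.
    - by case/finj.
    - by case/finj=> //; [exact: hA|move=> _ /iinj].
    - by case/finj=> //; [exact: hA|move=> _ /iinj].
    - by case/finj=> //; [exact: hA|exact: hA|move=> + _; apply: hi].
  exists (fun x y => f (e x) (e y)) => a b c d.
  by move=> /(finj _ _ _ _ (eA _) (eA _) (eA _) (eA _))[/ei -> /ei ->].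
have [g [gi gA]] := card_le_inj_on k0 AC; exfalso.
pose B := g @` A.
have AB x : A x -> B x -> False by move=> Ax [y Ay yx]; case: (gA _ Ay); rewrite yx.
have /choice[pi piP] : forall x, exists y, [/\ A x -> y = x, B x -> A y & B x -> g y = x].
  move=> x; case: (pselect (A x)) => Ax.
    by exists x; split=> // /(AB _ Ax).
  case: (pselect (B x)) => [[y Ay <-]|nB]; last by exists x.
  by exists y; split=> // /(gA _ Ay).
pose AuB := A `|` B.
have piA x : AuB x -> A (pi x).
  by have [h1 h2 _] := piP x; case=> h; [rewrite h1|apply: h2].
(* As [pi] identifies [B] with [A], a code must also record which coordinates lie in [A]. Three
   values suffice because pairs inside [A] keep their old codes. *)
pose tag x y := if pselect (A x) then i 0 else if pselect (A y) then i 1 else i 2.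
have tagA x y : A (tag x y) by rewrite /tag; case: pselect => ?; [|case: pselect => ?]; apply: Ai.
pose new x y := g (f (f (pi x) (pi y)) (tag x y)).
have newB x y : AuB x -> AuB y -> B (new x y).
  by move=> hx hy; apply: imageP; apply: (fA) (tagA _ _); apply: fA; apply: piA.
pose N := M `|` [set t | [/\ AuB t.1.1, AuB t.1.2, ~ (A t.1.1 /\ A t.1.2) & t.2 = new t.1.1 t.1.2]].
have domN x : dom N x = AuB x.
  apply/propext; split=> [[c [/Mdom[Ax _ _]|[]//]]|]; first by left.
  move=> hx; case: (pselect (A x)) => Ax.
    by exists (f x x); left; apply: fM.
  by exists (new x x); right; split=> //=; tauto.
have MA a b c : M (a, b, c) -> [/\ A a, A b & A c] by apply: Mdom.
apply: (Rmax N).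
  split; first by move=> p Rp; left; left.
  move=> NR; have hb : AuB (g (i 0)) by right; apply: imageP.
  have : N (g (i 0), g (i 0), new (g (i 0)) (g (i 0))).
    by right; split=> //= -[] Ag _; apply: (AB _ Ag); apply: imageP.
  move=> /NR Rg; have [Ag _ _] := MA _ _ _ (or_introl Rg : M _).
  by apply: (AB _ Ag); apply: imageP.
suff: pairing_rel N.
  suff -> : N `|` R0 = N by [].
  by apply/seteqP; split=> [x [//|R0x]|x]; [left; right|left].
split.
- move=> a b a' b' c [h|[/= ha hb nab ec]] [h'|[/= ha' hb' nab' ec']].
  + exact: Minj h h'.
  + by have [_ _ /AB[]] := MA _ _ _ h; rewrite ec'; apply: newB.
  + by have [_ _ /AB[]] := MA _ _ _ h'; rewrite ec; apply: newB.
  + have cA u v : AuB u -> AuB v -> A (f (f (pi u) (pi v)) (tag u v)).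
      by move=> hu hv; apply: (fA) (tagA _ _); apply: fA; apply: piA.
    move: ec; rewrite {}ec' => /(gi _ _ (cA _ _ ha' hb') (cA _ _ ha hb)).
    move=> /(finj _ _ _ _ (fA _ _ (piA _ ha') (piA _ hb')) (tagA _ _)
                          (fA _ _ (piA _ ha) (piA _ hb)) (tagA _ _))[].
    move=> /(finj _ _ _ _ (piA _ ha') (piA _ hb') (piA _ ha) (piA _ hb))[e1 e2].
    have same x y : AuB x -> AuB y -> (A x <-> A y) -> pi x = pi y -> x = y.
      have [px1 _ px2] := piP x; have [py1 _ py2] := piP y.
      move=> hx hy xy e; case: (pselect (A x)) => Ax.
        by rewrite -px1 // e py1 //; apply/xy.
      have nAy : ~ A y by rewrite -xy.
      by rewrite -px2 ?e ?py2 //; [case: hy|case: hx].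
    rewrite /tag => tt; suff [h1 h2] : (A a <-> A a') /\ (A b <-> A b').
      by split; apply: same.
    by move: tt; do 4?[case: pselect => ?]; do ?[by move=> /iinj]; tauto.
- move=> a b c [/MA[Aa Ab Ac]|[/= ha hb _ ->]]; rewrite !domN; first by split; left.
  by split=> //; right; apply: newB.
- move=> a b; rewrite !domN => ha hb.
  case: (pselect (A a /\ A b)) => [[Aa Ab]|nab].
    by exists (f a b); left; apply: fM.
  by exists (new a b); right; split.
Qed.

End Square.

Lemma ordinal_type_on (T : Type) :
  exists lt : T -> T -> Prop,
    [/\ forall a b c, lt a b -> lt b c -> lt a c,
        forall a b, lt a b \/ a = b \/ lt b a & well_founded lt].
Proof.
elim/Peq: T => T.
have [R Rwo] := wochoice.well_ordering_principle T.
have Rmin (A : {pred T}) x : x \in A ->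
    exists z, z \in A /\ forall y, y \in A -> R z y.
  by move=> Ax; have [|z [[Az zP] _]] := Rwo A; [exists x|exists z].
have Ranti x y : R x y -> R y x -> x = y.
  move=> xy yx; have Rxx z : R z z.
    have [|u [/eqP-> h]] := Rmin (pred1 z) z; first by rewrite inE.
    by apply: h; rewrite inE.
  have [|z [_ zu]] := Rwo (pred2 x y); first by exists x; rewrite inE eqxx.
  have zx : z = x by apply: zu; split; [rewrite inE eqxx|move=> u /pred2P[] ->].
  by rewrite -zx; apply: zu; split; [rewrite inE eqxx orbT|move=> u /pred2P[] ->].
have Rtot x y : R x y \/ R y x.
  have [|z [/pred2P[] -> h]] := Rmin (pred2 x y) x; rewrite ?inE ?eqxx //.
    by left; apply: h; rewrite inE eqxx orbT.
  by right; apply: h; rewrite inE eqxx.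
exists (fun x y => R x y /\ x <> y); split.
- move=> a b c [ab nab] [bc nbc].
  have [|z [/or3P[]/eqP-> h]] := Rmin [pred x | [|| x == a, x == b | x == c]] a;
    rewrite ?inE ?eqxx //.
  + split; first by apply: h; rewrite inE eqxx !orbT.
    by move=> ac; apply: nbc; apply: Ranti => //; rewrite -ac.
  + by case: nab; apply: Ranti => //; apply: h; rewrite inE eqxx.
  + by case: nbc; apply: Ranti => //; apply: h; rewrite inE eqxx orbT.
- move=> a b; case: (pselect (a = b)) => ab; first by right; left.
  by have [] := Rtot a b; [left|right; right]; split=> // ?; apply: ab.
- move=> x; apply: contrapT => nx.
  have [|z [/asboolP nz zmin]] := Rmin [pred y | `[< ~ Acc (fun x y => R x y /\ x <> y) y >]] x.
    exact/asboolP.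
  apply: nz; constructor=> y [yz nyz]; apply: contrapT => ny.
  by apply: nyz; apply: Ranti => //; apply: zmin; apply/asboolP.
Qed.

Lemma wf_min (A : ordinal_type) (P : A -> Prop) :
  (exists a, P a) -> exists a, P a /\ forall b, ord_lt b a -> ~ P b.
Proof.
move=> [a Pa]; apply: contrapT => nex; move: Pa.
elim/(well_founded_ind (@ord_lt_wf A)): a => a IH Pa.
by apply: nex; exists a; split=> // b /IH.
Qed.

(** * Arithmetic of an infinite cardinal and its successor *)

Section InfiniteCardinal.
Variables (K : Type) (K_infinite : infinite_set [set: K]).

Lemma infinite_inhabited : inhabited K.
Proof. by have [x _] := infinite_setN0 K_infinite. Qed.

Lemma card_le_prod T U (A : set T) (B : set U) :
  A #<= [set: K] -> B #<= [set: K] -> A `*` B #<= [set: K].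
Proof.
have [k0] := infinite_inhabited; have [p pinj] := infinite_pairing K_infinite.
move=> /(card_le_inj_on k0)[f [fi _]] /(card_le_inj_on k0)[g [gi _]].
apply: (@inj_on_card_le _ _ _ _ (fun x => p (f x.1) (g x.2))) => //.
move=> [a b] [c d] [/= Aa Bb] [/= Ac Bd] /pinj[].
by move=> /(fi _ _ Aa Ac) -> /(gi _ _ Bb Bd) ->.
Qed.

Lemma countable_card_le (T : countType) (A : set T) : A #<= [set: K].
Proof.
have [k0] := infinite_inhabited.
have [f [fi _]] := card_le_inj_on k0 (iffLR (infiniteP _) K_infinite).
apply: (@inj_on_card_le _ _ _ _ (f \o pickle)) => // x y _ _ /fi e.
exact: (pcan_inj (@pickleK _) (e I I)).
Qed.

Lemma card_le_setT_prod T U : [set: T] #<= [set: K] -> [set: U] #<= [set: K] ->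
  [set: T * U] #<= [set: K].
Proof.
by move=> h1 h2; have := card_le_prod h1 h2; rewrite setXTT.
Qed.

Lemma card_le_seq T : [set: T] #<= [set: K] -> [set: seq T] #<= [set: K].
Proof.
have [k0] := infinite_inhabited; have [p pinj] := infinite_pairing K_infinite.
move=> /(card_le_inj_on k0)[f [fi _]].
(* [k0] may itself be the code of a pair, so [g] is injective only among sequences of equal length;
   hence the length is stored beside it. *)
pose g := foldr (fun x k => p (f x) k) k0.
have := card_le_setT_prod (countable_card_le [set: nat]) (card_lexx [set: K]).
apply: card_le_trans; apply: (@inj_on_card_le _ _ _ _ (fun s => (size s, g s))) => //.
move=> s t _ _ []; elim: s t => [|x s IH] [|y t] //= [e] /pinj[xy st].
by rewrite (fi _ _ I I xy) (IH _ e st).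
Qed.

Lemma card_le_bigcup T I (D : set I) (F : I -> set T) :
  D #<= [set: K] -> (forall i, D i -> F i #<= [set: K]) ->
  \bigcup_(i in D) F i #<= [set: K].
Proof.
have [k0] := infinite_inhabited.
move=> hD hF; have := card_le_prod hD (card_lexx [set: K]); apply: card_le_trans.
case: (pselect (exists i, D i)) => [[i0 _]|nD]; last first.
  suff -> : \bigcup_(i in D) F i = set0 by exact: card_ge0.
  by apply/seteqP; split=> // x [i Di _]; apply: nD; exists i.
have /choice[g gP] : forall i, exists g : T -> K, D i -> inj_on (F i) g.
  move=> i; case: (pselect (D i)) => Di; last by exists (fun _ => k0).
  by have [g [gi _]] := card_le_inj_on k0 (hF _ Di); exists g.
have /choice[c cP] : forall x, exists i, (\bigcup_(i in D) F i) x -> D i /\ F i x.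
  move=> x; case: (pselect ((\bigcup_(i in D) F i) x)) => [[i Di Fx]|nx].
    by exists i.
  by exists i0.
apply: (@inj_on_card_le _ _ _ _ (fun x => (c x, g (c x) x))).
  move=> x y /cP[Dx Fx] /cP[Dy Fy] [e]; rewrite -e; apply: gP => //.
  by rewrite e.
by move=> x /cP[].
Qed.

(** Hartogs' construction inside a well-order of the power set of [K]: [S] consists of the elements
    with at most [K] predecessors. If [S] had size at most [K], a least element outside [S] would
    have too few predecessors to be outside, so [S] would be the whole power set. The last clause is
    a transfinite recursion: the values used so far never exhaust [A], because segments of [S] are
    small. *)
Lemma exists_successor : exists S : ordinal_type,
  [/\ forall a : S, [set b | ord_lt b a] #<= [set: K],
      ~ ([set: S] #<= [set: K])
    & forall T (A : set T), ~ (A #<= [set: K]) -> [set: S] #<= A].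
Proof.
have [k0] := infinite_inhabited.
have [lt [tr tot wf]] := ordinal_type_on (K -> Prop).
pose W := OrdinalType tr tot wf.
pose small (w : W) := [set v | lt v w] #<= [set: K].
pose St := {w | small w}; pose slt (a b : St) := lt (sval a) (sval b).
have S_tot a b : slt a b \/ a = b \/ slt b a.
  have [h|[h|h]] := tot (sval a) (sval b); [by left| |by right; right].
  right; left; case: a b h => [a ha] [b hb] /= h.
  by move: hb; rewrite -h => hb; congr exist; apply: Prop_irrelevance.
have S_wf : well_founded slt.
  case=> w; elim/(well_founded_ind wf): w => w IH hw.
  by constructor=> -[v hv] vw; apply: IH.
pose S := @OrdinalType St slt (fun a b c => @tr _ _ _) S_tot S_wf.
have segS (a : S) : [set b | ord_lt b a] #<= [set: K].
  apply: card_le_trans (svalP a); apply: (@inj_on_card_le _ _ _ _ (fun b : S => sval b)) => //.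
  by move=> [x hx] [y hy] _ _ /= xy; move: hy; rewrite -xy => hy; congr exist; apply: Prop_irrelevance.
have SK : ~ ([set: S] #<= [set: K]).
  move=> SK; have allS w : small w.
    apply: contrapT => nw; have [w0 [nw0 w0min]] := @wf_min W (fun w => ~ small w) (ex_intro _ w nw).
    apply: (nw0); apply: card_le_trans SK.
    have /choice[f fP] : forall v, exists s : S, lt v w0 -> sval s = v.
      move=> v; case: (pselect (lt v w0)) => vw; last first.
        have [s _] : exists s : S, True; last by exists s.
        apply: contrapT => nS; apply: nw0; rewrite /small.
        suff -> : [set v | lt v w0] = set0 by exact: card_ge0.
        apply/seteqP; split=> // u uw; apply: nS.
        by exists (exist _ u (contrapT (w0min _ uw))).
      by exists (exist _ v (contrapT (w0min _ vw))).
    apply: (@inj_on_card_le _ _ _ _ f) => // x y /fP xE /fP yE e.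
    by rewrite -xE e yE.
  have [f [fi _]] := card_le_inj_on k0 SK.
  (* Cantor's diagonal set for the injection [f] of the power set of [K] into [K]. *)
  pose D k := exists w : W, f (exist _ w (allS w)) = k /\ ~ w k.
  have : ~ (D (f (exist _ D (allS D)))) <-> D (f (exist _ D (allS D))).
    split=> [nD|[w [/fi e nw]]]; first by exists D.
    have wD : w = D by have := e I I; case.
    by move=> DD; apply: nw; rewrite {1}wD.
  tauto.
exists S; split=> // T A nA.
have [t0 _] : exists t, A t.
  apply: contrapT => nt; apply: nA; suff -> : A = set0 by exact: card_ge0.
  by apply/seteqP; split=> // t At; apply: nt; exists t.
have /choice[pick pickP] : forall P : T -> Prop, exists t, (exists u, P u) -> P t.
  by move=> P; case: (pselect (exists u, P u)) => [[u Pu]|nP]; [exists u|exists t0].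
pose step (a : S) (rec : forall b : S, ord_lt b a -> T) : T :=
  pick (fun t => A t /\ forall b (ba : ord_lt b a), rec b ba <> t).
pose h := Fix (@ord_lt_wf S) (fun _ => T) step.
have hE a : h a = pick (fun t => A t /\ forall b, ord_lt b a -> h b <> t).
  rewrite /h Fix_eq // => x f g fg; congr step.
  by apply: functional_extensionality_dep => b; apply: functional_extensionality_dep.
have hP a : A (h a) /\ forall b, ord_lt b a -> h b <> h a.
  have ex : exists t, A t /\ forall b, ord_lt b a -> h b <> t.
    apply: contrapT => nex; apply: nA; apply: card_le_trans (segS a).
    have /choice[g gP] : forall t, exists b, A t -> ord_lt b a /\ h b = t.
      move=> t; case: (pselect (A t)) => At; last by exists a.
      apply: contrapT => nb; apply: nex; exists t; split=> // b ba e.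
      by apply: nb; exists b.
    apply: (@inj_on_card_le _ _ _ _ g); last by move=> t /gP[].
    by move=> x y /gP[_ ex] /gP[_ ey] e; rewrite -ex e.
  by rewrite hE; exact: (pickP _ ex).
apply: (@inj_on_card_le _ _ _ _ h); last by move=> a _; case: (hP a).
move=> a b _ _ e; have [ab|[//|ba]] := ord_lt_total a b.
  by case: (hP b) => _ /(_ _ ab).
by case: (hP a) => _ /(_ _ ba); rewrite e.
Qed.

End InfiniteCardinal.

(** Regularity of the successor cardinal: if the values were unbounded, [S] would be covered by at
    most [K] closed initial segments, each of size at most [K]. *)
Lemma ord_lt_bounded (K : Type) (K_infinite : infinite_set [set: K])
    (S : ordinal_type) T (A : set T) (f : T -> S) :
  (forall a : S, [set b | ord_lt b a] #<= [set: K]) ->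
  ~ ([set: S] #<= [set: K]) -> A #<= [set: K] ->
  exists b, forall x, A x -> ord_lt (f x) b.
Proof.
move=> seg SK AK; apply: contrapT => nb; apply: SK.
pose F x := [set b | ord_lt b (f x)] `|` [set f x].
apply: (@card_le_trans _ _ _ (\bigcup_(x in A) F x)).
  apply: subset_card_le => b _; apply: contrapT => nF; apply: nb.
  exists b => x Ax; have [//|[e|bx]] := ord_lt_total (f x) b.
    by case: nF; exists x => //; right.
  by case: nF; exists x => //; left.
apply: card_le_bigcup => // x _.
have [p pinj] := infinite_pairing K_infinite.
have [k0] := infinite_inhabited K_infinite.
have [g [gi _]] := card_le_inj_on k0 (seg (f x)).
apply: (@card_le_trans _ _ _ [set: bool * K]); last first.
  by apply: card_le_setT_prod => //; apply: countable_card_le.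
pose e b := if `[< b = f x >] then (true, k0) else (false, g b).
apply: (@inj_on_card_le _ _ _ _ e) => // a b Fa Fb.
rewrite /e; case: asboolP => [-> | na]; case: asboolP => [-> // | nb'] // [].
by apply: gi; [case: Fa|case: Fb].
Qed.

(** * Paths in a graph *)

Section Joined.
Variable G : graph.
Implicit Types x y z : G.

Lemma joined_refl x : joined x x.
Proof.
by exists 0, (fun _ => x); split=> //; split=> // -[|i] [|j].
Qed.

Lemma joined_step x y z : joined x y -> adj y z -> joined x z.
Proof.
move=> [n [p [[pinj padj] p0 pn]]] yz.
(* Paths are injective, so one that already visits [z] is cut off there. *)
case: (pselect (exists k, k <= n /\ p k = z)) => [[k [kn pk]]|nk].
  exists k, p; split=> //; split=> [i j ik jk|i ik]; last by apply: padj; lia.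
  by apply: pinj; lia.
exists n.+1, (fun i => if i == n.+1 then z else p i); split=> //; last by rewrite eqxx.
split=> [i j|i]; last first.
  rewrite ltnS eqSS leq_eqVlt => /orP[/eqP->|i_n].
    by rewrite eqxx ltn_eqF // pn.
  by rewrite !ltn_eqF ?ltnS // 1?ltnW //; apply: padj.
case: eqP => [-> _|ni i_n]; case: eqP => [-> _|nj j_n] //.
- by move=> e; case: nk; exists j; split=> //; lia.
- by move=> e; case: nk; exists i; split=> //; lia.
- by apply: pinj; lia.
Qed.

Lemma joined_trans x y z : joined x y -> joined y z -> joined x z.
Proof.
move=> xy [n [p [[_ padj] p0 <-]]].
have: forall k, k <= n -> joined x (p k).
  elim=> [|k IH] kn; first by rewrite p0.
  by apply: joined_step (IH _) (padj _ kn); lia.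
exact.
Qed.

Lemma joined_sym x y : joined x y -> joined y x.
Proof.
move=> [n [p [[_ padj] <- <-]]].
have: forall k, k <= n -> joined (p k) (p 0).
  elim=> [|k IH] kn; first exact: joined_refl.
  apply: joined_trans (IH _); last by lia.
  by apply: joined_step (joined_refl _) _; apply/adj_sym/padj.
exact.
Qed.

Lemma joined_closed (B : set G) x y :
  joined x y -> B x -> (forall u v, B u -> adj u v -> B v) -> B y.
Proof.
move=> [n [p [[_ padj] p0 <-]]] Bx Badj.
have: forall k, k <= n -> B (p k).
  elim=> [|k IH] kn; first by rewrite p0.
  by apply: Badj (IH _) (padj _ kn); lia.
exact.
Qed.

End Joined.

(** * Trees of blocks *)

(** [Node n f] is a cactus with a root: the index [i] stands for a block through
    the root that has [block_size (n i)] further vertices, and the block's [j]-th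
    further vertex is the root of the cactus [f i j]. *)
Inductive tree (K : Type) : Type :=
| Leaf : tree K
| Node : (K -> nat) -> (K -> nat -> tree K) -> tree K.
Arguments Leaf {K}.

(** A block is an edge or an odd cycle; any other size means that there is no
    block. *)
Definition block_size m := if (m == 1) || ~~ odd m then m else 0.

Section Tree.
Variable K : Type.
Implicit Types t : tree K.

Definition arity t i := if t is Node n _ then block_size (n i) else 0.
Definition child t i j := if t is Node _ f then f i j else Leaf.

Lemma tree_child_ind (P : tree K -> Prop) :
  (forall t, (forall i j, j < arity t i -> P (child t i j)) -> P t) -> forall t, P t.
Proof. by move=> h; elim=> [|n f IH]; apply: h => i j // _; apply: IH. Qed.

Lemma arityP t i : arity t i = 1 \/ ~~ odd (arity t i).
Proof.
case: t => [|n f] /=; first by right.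
by rewrite /block_size; case: ifP => [/orP[/eqP->|]|]; auto.
Qed.

(** A vertex is given by the way to it from the root. *)
Definition address := seq (K * nat).
Implicit Types x y v w : address.

Fixpoint in_tree t x {struct x} : Prop :=
  if x is (i, j) :: x' then j < arity t i /\ in_tree (child t i j) x' else True.

(** Adjacency on a cycle with the vertices [None, Some 0, ..., Some m.-1], and
    on an edge for [m = 1]. *)
Definition block_adj m (o o' : option nat) : Prop :=
  match o, o' with
  | None, None => False
  | None, Some j | Some j, None => j = 0 \/ j.+1 = m
  | Some j, Some k => k = j.+1 \/ j = k.+1
  end.

Fixpoint tree_adj t x y {struct x} : Prop :=
  match x, y with
  | [::], [::] => False
  | [::], (i, j) :: y' => y' = [::] /\ block_adj (arity t i) None (Some j)
  | (i, j) :: x', [::] => x' = [::] /\ block_adj (arity t i) (Some j) None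
  | (i, j) :: x', (i', j') :: y' => i = i' /\
      ((j = j' /\ tree_adj (child t i j) x' y') \/
       [/\ x' = [::], y' = [::] & block_adj (arity t i) (Some j) (Some j')])
  end.

Lemma tree_adj_sym t x y : tree_adj t x y -> tree_adj t y x.
Proof.
elim: x t y => [|[i j] x IH] t [|[i' j'] y] //=.
move=> [<- [[<- /IH h]|[-> -> h]]]; split=> //; first by left.
by right; split=> //; case: h => ->; [right|left].
Qed.

Lemma tree_adj_irrefl t x : ~ tree_adj t x x.
Proof.
elim: x t => [|[i j] x IH] t //= [_ [[_ /IH]//|[_ _ h]]].
by case: h; lia.
Qed.

Fixpoint subtree t v {struct v} : tree K :=
  if v is (i, j) :: v' then subtree (child t i j) v' else t.

Lemma tree_adj_cases t x y : tree_adj t x y ->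
  [\/ exists i j, y = x ++ [:: (i, j)] /\ (j = 0 \/ j.+1 = arity (subtree t x) i),
      exists i j, x = y ++ [:: (i, j)]
    | exists v i j j', [/\ x = v ++ [:: (i, j)], y = v ++ [:: (i, j')] &
                           j' = j.+1 \/ j = j'.+1]].
Proof.
elim: x t y => [|[i j] x IH] t [|[i' j'] y] //=.
- by move=> [-> h]; apply: Or31; exists i', j'.
- by move=> [-> h]; apply: Or32; exists i, j.
move=> [<- [[<- /IH[]]|[-> -> h]]].
- by move=> [k [l [-> h]]]; apply: Or31; exists k, l.
- by move=> [k [l ->]]; apply: Or32; exists k, l.
- by move=> [v [k [l [l' [-> -> h]]]]]; apply: Or33; exists ((i, j) :: v), k, l, l'.
- by apply: Or33; exists [::], i, j, j'.
Qed.

Definition below v i : set address := [set x | exists j w, x = v ++ (i, j) :: w].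

Lemma catI v : injective (cat v).
Proof. by elim: v => [|a v IH] x y //= [] /IH. Qed.

(** The cut-vertex property of [v], on which the arguments about cycles and paths rest. *)
Lemma below_leave t v i x y :
  tree_adj t x y -> below v i x -> ~ below v i y -> y = v.
Proof.
move=> xy [j [w xE]]; move: xy; rewrite {}xE.
elim: v t y => [|[i' j'] v IH] t [|[i1 j1] y] //=.
- by move=> [<- _]; case; exists j1, y.
- by move=> [+ _]; case: v {IH}.
- move=> [<- [[<- xy]|[+ _ _]]]; last by case: v {IH}.
  move=> ny; rewrite (IH _ _ xy) // => -[k [z yE]]; apply: ny.
  by exists k, z; rewrite yE.
Qed.

Lemma below_exit t (c : nat -> address) v i k l :
  (forall m, k <= m < l -> tree_adj t (c m) (c m.+1)) ->
  below v i (c k) -> k <= l -> ~ below v i (c l) ->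
  exists m, [/\ k < m, m <= l & c m = v].
Proof.
move=> cadj bk kl; move: cadj; rewrite -(subnKC kl).
elim: (l - k) {kl} => [|d IH] cadj; first by rewrite addn0.
case: (pselect (below v i (c (k + d)))) => bd nb.
  exists (k + d.+1); split=> //; [lia|].
  by apply: (@below_leave t) bd nb; rewrite addnS; apply: cadj; lia.
have [|m [km md cm]] := IH _ bd; first by move=> m md; apply: cadj; lia.
by exists m; split=> //; lia.
Qed.

Lemma tree_closed t (B : set address) :
  B [::] -> (forall x y, B x -> in_tree t x -> in_tree t y -> tree_adj t x y -> B y) ->
  forall x, in_tree t x -> B x.
Proof.
move=> B0 Badj x; elim: x t B B0 Badj => [|[i j] x IH] t B B0 Badj //= [jm xin].
apply: (IH (child t i j) (fun x => B ((i, j) :: x))) => // [|y z By yin zin yz].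
  elim: j jm {xin} => [|j IHj] jm; first by apply: (Badj [::]) => //=; auto.
  apply: (Badj [:: (i, j)]) => //=; first by apply: IHj; lia.
    by split=> //; lia.
  by split=> //; right; split=> //; left.
by apply: (Badj ((i, j) :: y)) => //=; split=> //; left.
Qed.

Lemma inj_avoid T (r : nat -> T) (g : nat -> T) m : injective r ->
  exists N, forall k, N <= k -> forall j, j < m -> r k <> g j.
Proof.
move=> rinj; elim: m => [|m [N NP]]; first by exists 0.
case: (pselect (exists k, r k = g m)) => [[k0 rk0]|nk].
  exists (maxn N k0.+1) => k kN j; rewrite ltnS leq_eqVlt => /orP[/eqP->|jm].
    by rewrite -rk0 => /rinj; lia.
  by apply: NP => //; lia.
exists N => k kN j; rewrite ltnS leq_eqVlt => /orP[/eqP-> e|]; last exact: NP.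
by apply: nk; exists k.
Qed.

(** A ray eventually avoids the root, so from then on it stays below one block of the root. It
    eventually avoids the finitely many vertices of that block too, so it stays inside the tree of
    one child, where induction applies. *)
Lemma tree_rayless t (r : nat -> address) : injective r ->
  (forall k, in_tree t (r k)) -> (forall k, tree_adj t (r k) (r k.+1)) -> False.
Proof.
elim/tree_child_ind: t r => t IH r rinj rin radj.
have [N NP] := inj_avoid (fun _ => [::]) 1 rinj.
have hd k : exists i j x, r (N + k) = (i, j) :: x.
  case E: (r (N + k)) => [|[i j] x]; last by exists i, j, x.
  by have := NP _ (leq_addr k N) 0 isT E.
have [i [j0 [x0 E0]]] := hd 0.
have hdi k : exists j x, r (N + k) = (i, j) :: x.
  elim: k => [|k [j [x E]]]; first by exists j0, x0.
  have [i' [j' [x' E']]] := hd k.+1; have := radj (N + k).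
  by rewrite -addnS E E' => -[<- _]; exists j', x'.
have [M MP] := inj_avoid (fun j => [:: (i, j)]) (arity t i) rinj.
have [j [x1 E1]] := hdi M.
have tl k : exists x, r (N + M + k) = (i, j) :: x.
  elim: k => [|k [x E]]; first by exists x1; rewrite addn0.
  have [j' [x' E']] := hdi (M + k.+1); rewrite addnA in E'.
  have := radj (N + M + k); rewrite -addnS E E' => -[_ [[<- _]|]].
    by exists x'.
  move=> [x_nil _ _]; have := rin (N + M + k); rewrite E /= => -[jm _].
  by case: (MP (N + M + k) _ j jm); [lia|rewrite E x_nil].
have /choice[s sP] := tl.
have ji : j < arity t i by have := rin (N + M); rewrite E1 => -[].
apply: (IH i j ji s).
- by move=> a b ab; have := sP a; rewrite ab -sP => /rinj; lia.
- by move=> k; have := rin (N + M + k); rewrite sP => -[].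
- move=> k; have := radj (N + M + k); rewrite -addnS !sP => -[_ [[_]//|]].
  by move=> [_ _]; case; lia.
Qed.

(** This describes an injective passage through a block: reversing the direction would mean
    returning at once to the previous vertex. *)
Lemma unit_steps_monotone (j : nat -> nat) N :
  (forall k, k < N -> j k.+1 = (j k).+1 \/ j k = (j k.+1).+1) ->
  (forall k, k.+1 < N -> j k.+2 <> j k) ->
  (forall k, k <= N -> j k = j 0 + k) \/ (forall k, k <= N -> j 0 = j k + k).
Proof.
elim: N => [|N IH] step inj; first by left; case=> // _; rewrite addn0.
have {IH} IH : (forall k, k <= N -> j k = j 0 + k) \/ (forall k, k <= N -> j 0 = j k + k).
  by apply: IH => [k kN|k kN]; [apply: step|apply: inj]; lia.
case: N => [|N] in step inj IH *.
  by have [h|h] := step 0 isT; [left|right]; case=> [|[|k]] //; lia.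
have s1 := step N.+1 (ltnSn _); have s2 := inj N (ltnSn _).
case: IH => IH; [left|right] => k; rewrite leq_eqVlt => /orP[/eqP->|kN].
- by have := IH N (leqnSn _); have := IH N.+1 (leqnn _); lia.
- exact: IH.
- by have := IH N (leqnSn _); have := IH N.+1 (leqnn _); lia.
- exact: IH.
Qed.

(** * Cycles in a tree of blocks *)

Section Cycle.
Variables (t : tree K) (n : nat) (c : nat -> address).
Hypotheses (n3 : 3 <= n) (c_per : forall k, c (n + k) = c k)
  (c_inj : forall k l, k < l -> l < k + n -> c k <> c l)
  (c_adj : forall k, tree_adj t (c k) (c k.+1))
  (c_min : forall k, size (c 0) <= size (c k)).

Lemma below_enter v i k l : below v i (c l) -> k <= l -> ~ below v i (c k) ->
  exists m, [/\ k <= m, m < l & c m = v].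
Proof.
move=> bl kl; have [d ->] : exists d, k = l - d by exists (l - k); lia.
elim: d => [|d IH] nb; first by move: nb; rewrite subn0.
case: (pselect (below v i (c (l - d)))) => bd; last first.
  by have [m [km ml cm]] := IH bd; exists m; split=> //; lia.
case: (leqP l d) => ld; first by move: nb; rewrite (_ : l - d.+1 = l - d); [|lia].
exists (l - d.+1); split=> //; [lia|].
apply: (@below_leave t) bd nb; apply: tree_adj_sym.
have e : (l - d.+1).+1 = l - d by lia.
by have := c_adj (l - d.+1); rewrite e.
Qed.

Lemma not_below_size v i x : size x <= size v -> ~ below v i x.
Proof. by move=> h [j [w xE]]; move: h; rewrite xE size_cat /=; lia. Qed.

(** A detour of the cycle below one of the vertices of a block passes through
    that vertex twice. *)
Lemma cycle_in_block v i a b k : below v i (c k) -> a <= k <= b -> b <= a + n ->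
  (b = a + n -> forall i', ~ below (c a) i' (c k)) ->
  size (c a) <= (size v).+1 -> size (c b) <= (size v).+1 ->
  exists j, c k = v ++ [:: (i, j)].
Proof.
move=> [j [[|[i' j'] w] E]] /andP[ak kb] ban nab sa sb; first by exists j.
have bk : below (v ++ [:: (i, j)]) i' (c k) by exists j', w; rewrite -catA.
have sz x : size x <= (size v).+1 -> ~ below (v ++ [:: (i, j)]) i' x.
  by move=> h; apply: not_below_size; rewrite size_cat addn1.
have [m [km mb cm]] := below_exit (fun m _ => c_adj m) bk kb (sz _ sb).
have [m' [km' mb' cm']] := below_enter bk ak (sz _ sa).
case: (ltnP m (m' + n)) => mn.
  by case: (@c_inj m' m _ mn _); [lia|rewrite cm cm'].
have ma : m' = a by lia.
by case: (nab _ i'); [lia|rewrite -ma cm'].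
Qed.

Lemma cycle_block_steps v i a b : a <= b -> b < a + n ->
  (forall k, a <= k <= b -> exists j, c k = v ++ [:: (i, j)]) ->
  exists j : nat -> nat, (forall k, k <= b - a -> c (a + k) = v ++ [:: (i, j k)]) /\
    ((forall k, k <= b - a -> j k = j 0 + k) \/ (forall k, k <= b - a -> j 0 = j k + k)).
Proof.
move=> ab ban cb.
have /choice[j jP] : forall k, exists j, k <= b - a -> c (a + k) = v ++ [:: (i, j)].
  move=> k; case: (leqP k (b - a)) => kb; last by exists 0.
  by have [|j e] := cb (a + k); [lia|exists j].
exists j; split=> //; apply: unit_steps_monotone => [k kb|k kb e].
  have := c_adj (a + k); rewrite -addnS !jP; [|lia|lia].
  move=> /tree_adj_cases[[i' [j' [/(congr1 size)]]]|[i' [j' /(congr1 size)]]|].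
  - by rewrite !size_cat /=; lia.
  - by rewrite !size_cat /=; lia.
  - move=> [v' [i' [j1 [j2 []]]]]; rewrite !cats1 => /rcons_inj[_ _ <-] /rcons_inj[_ _ <-].
    by case; lia.
by apply: (@c_inj (a + k) (a + k.+2)); rewrite ?jP ?e //; lia.
Qed.

(** The cycle starts at a vertex [v] of least depth. If it goes below [v], it stays below one block
    of [v] until it closes, so it is that block together with [v]. Otherwise it stays among the
    non-root vertices of the block that contains [v]; these induce a path, and no cycle closes
    there. *)
Lemma cycle_odd : odd n.
Proof.
have cn : c n = c 0 by rewrite -(c_per 0) addn0.
set v := c 0; have child_case i a : 0 < a < n -> below v i (c a) -> odd n.
  move=> an ba.
  have nv k : 0 < k < n -> c k <> v by move=> kn /esym; apply: c_inj; lia.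
  have vb : ~ below v i v by apply: not_below_size.
  have allb k : 0 < k < n -> below v i (c k).
    move=> kn; apply: contrapT => nb; case: (leqP a k) => ak.
      have [m [am mk cm]] := below_exit (fun m _ => c_adj m) ba ak nb.
      by apply: (nv m) => //; lia.
    have [m [am mk cm]] := below_enter ba (ltnW ak) nb.
    by apply: (nv m) => //; lia.
  have ends k : 0 < k < n -> tree_adj t v (c k) ->
      exists j, c k = v ++ [:: (i, j)] /\ (j = 0 \/ j.+1 = arity (subtree t v) i).
    move=> kn /tree_adj_cases[[i' [j [E h]]]|[i' [j E]]|].
    - have [j' [w]] := allb k kn; rewrite E => /catI[ii' _ _].
      by exists j; rewrite -ii'.
    - have [j' [w]] := allb k kn; rewrite E => /(congr1 size).
      by rewrite !size_cat /=; lia.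
    - move=> [u [i' [j [j' [E E' _]]]]]; have [k' [w]] := allb k kn.
      by rewrite E E' => /(congr1 size); rewrite !size_cat /=; lia.
  have [|j1 [E1 h1]] := ends 1 _ (c_adj 0); first by lia.
  have [||j2 [E2 h2]] := ends n.-1 _ _; [lia| |].
    have e : n.-1.+1 = n by lia.
    by apply: tree_adj_sym; rewrite /v -cn -{2}e.
  have blk k : 1 <= k <= n.-1 -> exists j, c k = v ++ [:: (i, j)].
    move=> kn; apply: (@cycle_in_block _ _ 1 n.-1); rewrite ?E1 ?E2 ?size_cat /= ?addn1 //; try lia.
    by apply: allb; lia.
  have [||j [jE mono]] := cycle_block_steps _ _ blk; [lia|lia|].
  have := jE 0; rewrite E1 !cats1 => /(_ isT) /rcons_inj[j1E].
  have := jE (n.-1 - 1) (leqnn _); rewrite subnKC; last by lia.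
  rewrite E2 !cats1 => /rcons_inj[j2E].
  have par := arityP (subtree t v) i.
  (* The cycle runs through the block from one end to the other in [n - 2] unit steps. Since [n] is
     at least 3, this arity is not 1, hence even. *)
  have : n = (arity (subtree t v) i).+1 by case: mono => /(_ _ (leqnn _)); lia.
  by move=> nE; case: par; [lia|rewrite nE].
have := c_adj 0; rewrite -/v => /tree_adj_cases[[i [j [E _]]]|[i [j E]]|].
- by apply: (child_case i 1); [lia|exists j, [::]; rewrite E].
- by have := c_min 1; rewrite -/v E size_cat /=; lia.
move=> [u [i [j [j' [E E' _]]]]].
have sz : size v = (size u).+1 by rewrite E size_cat addn1.
have allb k : k <= n -> below u i (c k).
  move=> kn; apply: contrapT => nb; have b0 : below u i (c 0) by exists j, [::].
  have [m [am mk cm]] := below_exit (fun m _ => c_adj m) b0 (leq0n k) nb.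
  by have := c_min m; rewrite cm -/v sz; lia.
case: (pselect (exists k i', k <= n /\ below v i' (c k))) => [[k [i' [kn bk]]]|nbv].
  apply: (child_case i' k) => //; case: k kn bk => [|k] kn bk.
    by have := @not_below_size v i' v (leqnn _).
  case: (ltnP k.+1 n) => // nk; have kE : k.+1 = n by lia.
  by move: bk; rewrite kE cn => /(@not_below_size v i' v (leqnn _)).
have blk k : 0 <= k <= n.-1 -> exists j, c k = u ++ [:: (i, j)].
  move=> kn; have kn' : k <= n by lia.
  apply: (@cycle_in_block _ _ 0 n) (allb _ kn') _ _ _ _ _; rewrite ?cn -/v ?sz //.
  by move=> _ i' bk; apply: nbv; exists k, i'.
have [||js [jE mono]] := cycle_block_steps _ _ blk; [lia|lia|].
have := c_adj n.-1; rewrite prednK; last by lia.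
have := jE (n.-1 - 0) (leqnn _); rewrite add0n subn0 => ->.
have := jE 0 isT; rewrite add0n cn => ->.
move=> /tree_adj_cases[[i' [j1 [/(congr1 size)]]]|[i' [j1 /(congr1 size)]]|].
- by rewrite !size_cat /=; lia.
- by rewrite !size_cat /=; lia.
move=> [v' [i' [j1 [j2 []]]]]; rewrite !cats1 => /rcons_inj[_ _ <-] /rcons_inj[_ _ <-].
by case: mono => /(_ (n.-1 - 0) (leqnn _)); rewrite subn0; lia.
Qed.

End Cycle.

(** * The graph of a tree of blocks and its embeddings *)

Lemma in_graph_adj_sym t (x y : {x | in_tree t x}) :
  tree_adj t (sval x) (sval y) -> tree_adj t (sval y) (sval x).
Proof. exact: tree_adj_sym. Qed.

Lemma in_graph_adj_irrefl t (x : {x | in_tree t x}) : ~ tree_adj t (sval x) (sval x).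
Proof. exact: tree_adj_irrefl. Qed.

Definition tree_graph t : graph :=
  Graph (@in_graph_adj_sym t) (@in_graph_adj_irrefl t).

Lemma sval_inj T (P : T -> Prop) : injective (@sval T P).
Proof.
by move=> [x Px] [y Py] /= xy; move: Py; rewrite -xy => Py; congr exist; apply: Prop_irrelevance.
Qed.

Lemma tree_graph_connected t : connected (tree_graph t).
Proof.
pose r : tree_graph t := exist _ [::] I.
have rj (x : tree_graph t) : joined r x.
  pose B x := forall h : in_tree t x, joined r (exist _ x h : tree_graph t).
  suff: B (sval x) by case: x => x h; apply.
  apply: (@tree_closed t B); last exact: svalP.
    move=> h; have -> : exist _ [::] h = r by exact: sval_inj.
    exact: joined_refl.
  by move=> y z By yin zin yz h; apply: joined_step (By yin) _.
by split=> [|x y]; [exists r|apply: joined_trans (joined_sym (rj _)) (rj _)].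
Qed.

Lemma tree_graph_rayless t : rayless (tree_graph t).
Proof.
move=> [r [rinj radj]]; apply: (@tree_rayless t (fun k => sval (r k))).
- by move=> a b /sval_inj /rinj.
- by move=> k; apply: svalP.
- by move=> k; apply: radj.
Qed.

Lemma tree_graph_no_even_cycle t n : 3 <= n -> ~~ odd n ->
  ~ inhabited (immersion (cycle_graph n) (tree_graph t)).
Proof.
move=> n3 on [f].
have n0 : 0 < n by lia.
pose c k := sval (f (exist _ (k %% n) (ltn_pmod k n0) : cycle_graph n)).
(* The cycle is shifted to start at a vertex of least depth. *)
have [s smin] : exists s, forall k, size (c s) <= size (c k).
  have ex : exists m, `[< exists k, size (c k) = m >].
    by exists (size (c 0)); apply/asboolP; exists 0.
  case: (ex_minnP ex) => m /asboolP[s <-] smin.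
  by exists s => k; apply: smin; apply/asboolP; exists k.
move/negP: on; apply; apply: (@cycle_odd t n (fun k => c (s + k))) => //.
- by move=> k; rewrite /c; congr (sval (f _)); apply: sval_inj => /=;
    rewrite addnCA modnDl.
- move=> k l kl ln /sval_inj/(@im_inj _ _ f)/(congr1 (@sval _ _)) /= /eqP.
  rewrite eqn_modDl eq_sym eqn_mod_dvd; last by lia.
  by move=> /dvdn_leq; lia.
- move=> k; apply: (@im_adj _ _ f) => /=; split; last first.
    by left; rewrite /= addnS -[in RHS]addn1 modnDml addn1.
  move=> /(congr1 (@sval _ _)) /= /esym/eqP.
  rewrite addnS eqn_mod_dvd ?leqnSn // subSnn dvdn1; lia.
- by move=> k; rewrite addn0.
Qed.

Lemma tree_graph_avoiding t : infinite_set [set: K] ->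
  avoiding K even_cycles (tree_graph t).
Proof.
move=> Kinf; split; last first.
  by move=> _ [n [n3 on ->]]; apply: tree_graph_no_even_cycle.
split; [exact: tree_graph_connected|exact: tree_graph_rayless|].
have : [set: address] #<= [set: K].
  apply: card_le_seq => //; apply: card_le_setT_prod; rewrite ?card_lexx //.
  exact: countable_card_le.
apply: card_le_trans; apply: (@inj_on_card_le _ _ _ _ (fun x : tree_graph t => sval x)) => //.
by move=> x y _ _ /sval_inj.
Qed.

Inductive embeds : tree K -> tree K -> Prop :=
  Embeds t u (s : K -> K) :
    (forall i i', 0 < arity t i -> 0 < arity t i' -> s i = s i' -> i = i') ->
    (forall i, 0 < arity t i -> arity u (s i) = arity t i) ->
    (forall i j, j < arity t i -> embeds (child t i j) (child u (s i) j)) ->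
    embeds t u.

Definition embedding t u (h : address -> address) : Prop :=
  [/\ forall x, in_tree t x -> in_tree u (h x),
      forall x y, in_tree t x -> in_tree t y -> h x = h y -> x = y
    & forall x y, in_tree t x -> in_tree t y -> (tree_adj t x y <-> tree_adj u (h x) (h y))].

(** The blocks of [u] that meet the image are the images of blocks of [t]: so
    one leaves the image only through a block whose other vertices miss it. *)
Definition block_closed t u (h : address -> address) : Prop :=
  forall x y, in_tree t x -> in_tree u y -> tree_adj u (h x) y -> ~ (h @` in_tree t) y ->
  exists i, below (h x) i y /\ forall z, in_tree t z -> ~ below (h x) i (h z).

(** The embedding renames the block indices along an address and keeps the positions inside the
    blocks, so adjacency within a block is untouched. *)
Lemma embeds_embedding t u : embeds t u ->
  exists h, [/\ h [::] = [::], embedding t u h & block_closed t u h].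
Proof.
elim=> {t u} t u s sinj ssize _ IH.
have /choice[F FP] : forall ij : K * nat, exists h, ij.2 < arity t ij.1 ->
    [/\ h [::] = [::], embedding (child t ij.1 ij.2) (child u (s ij.1) ij.2) h &
        block_closed (child t ij.1 ij.2) (child u (s ij.1) ij.2) h].
  move=> [i j]; case: (ltnP j (arity t i)) => ji; last by exists id => /=; lia.
  by have [h hP] := IH _ _ ji; exists h.
have pos i j : j < arity t i -> 0 < arity t i by lia.
have Fnil i j x : j < arity t i -> in_tree (child t i j) x ->
    F (i, j) x = [::] <-> x = [::].
  move=> ji xin; have [F0 [_ Finj _] _] := FP (i, j) ji.
  by split=> [e|-> //]; apply: Finj => //; rewrite e F0.
pose h x := if x is (i, j) :: x' then (s i, j) :: F (i, j) x' else [::].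
exists h; split=> //; first split.
- move=> [|[i j] x] //= [ji xin]; rewrite ssize ?(pos _ _ ji) //; split=> //.
  by have [_ [Fin _ _] _] := FP (i, j) ji; apply: Fin.
- move=> [|[i j] x] [|[i' j'] y] //= [ji xin] [ji' yin] [/sinj e ee].
  have {}e := e (pos _ _ ji) (pos _ _ ji'); subst i' j'.
  by have [_ [_ Finj _] _] := FP (i, j) ji => /Finj ->.
- move=> [|[i j] x] [|[i' j'] y] //=.
  + by move=> _ [ji yin]; rewrite ssize ?(pos _ _ ji) // Fnil.
  + by move=> [ji xin] _; rewrite ssize ?(pos _ _ ji) // Fnil.
  + move=> [ji xin] [ji' yin].
    have [_ [_ _ Fadj] _] := FP (i, j) ji.
    split=> [[ii' xy]|[/sinj ii' xy]]; last first.
      have {}ii' := ii' (pos _ _ ji) (pos _ _ ji'); subst i'; split=> //.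
      case: xy => [[jj' xy]|[h1 h2 h3]]; [left; subst j'|right].
        by split=> //; apply/Fadj.
      by split=> //; [apply/(Fnil i j)|apply/(Fnil i j')].
    subst i'; split=> //; case: xy => [[jj' xy]|[h1 h2 h3]]; [left; subst j'|right].
      by split=> //; apply/Fadj.
    by split=> //; [apply/(Fnil i j)|apply/(Fnil i j')].
have in_image i j y : j < arity t i -> (F (i, j) @` in_tree (child t i j)) y ->
    (h @` in_tree t) ((s i, j) :: y).
  by move=> ji [x xin <-]; exists ((i, j) :: x).
have nil_image i j : j < arity t i -> (h @` in_tree t) [:: (s i, j)].
  by move=> ji; apply: in_image => //; exists [::] => //; have [] := FP (i, j) ji.
move=> [|[i j] x] [|[k j'] y] //=.
(* At the root, a block [k] with a vertex outside the image is not [s i] for any block [i] of [t],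
   because [s] preserves block sizes. So nothing below it is in the image. *)
- move=> _ [jk yin] [y0 _] nim; exists k; split; first by exists j', y.
  move=> [|[i j] z] /=; first by move=> _ [? [? //]].
  move=> [ji zin] [j1 [w [sk _ _]]]; apply: nim; rewrite y0 -sk; apply: nil_image.
  by move: jk; rewrite -sk ssize ?(pos _ _ ji).
- by move=> _ _ _ []; exists [::].
move=> [ji xin] [jk yin] [sk h1] nim; subst k.
rewrite ssize ?(pos _ _ ji) // in jk.
case: h1 => [[jj' xy]|[_ y0 _]]; last by case: nim; rewrite y0; apply: nil_image.
subst j'; have [F0 [Fin Finj _] Fcl] := FP (i, j) ji.
have [|i' [[j' [w ->]] nb]] := Fcl _ _ xin yin xy; first by move=> /(in_image _ _ _ ji).
exists i'; split; first by exists j', w.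
move=> [|[i1 j1] z] /=; first by move=> _ [? [? //]].
move=> [ji1 zin] [j2 [w' [/sinj e ej]]].
have {}e := e (pos _ _ ji1) (pos _ _ ji); subst i1 j1 => zE.
by apply: (nb z) => //; exists j2, w'.
Qed.

(** Where the path leaves the image, at [h x], it enters a part that misses the image and is
    separated from the rest by [h x]. To come back it would have to visit [h x] a second time. *)
Lemma block_closed_path t u h (p : nat -> address) n : embedding t u h ->
  block_closed t u h -> (forall i j, i <= n -> j <= n -> p i = p j -> i = j) ->
  (forall k, k <= n -> in_tree u (p k)) ->
  (forall k, k < n -> tree_adj u (p k) (p k.+1)) ->
  (h @` in_tree t) (p 0) -> (h @` in_tree t) (p n) ->
  forall k, k <= n -> (h @` in_tree t) (p k).
Proof.
move=> [hin hinj hadj] hcl pinj pin padj p0 pn.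
elim=> [//|k IH] kn; apply: contrapT => nk.
have [x xin xk] := IH (ltnW kn).
have := padj _ kn; rewrite -xk => xadj.
have [i [bk nb]] := hcl _ _ xin (pin _ kn) xadj nk.
have [||m [km mn mE]] := @below_exit u p (h x) i k.+1 n _ bk kn.
- by move=> m mn; apply: padj; lia.
- by have [z zin <-] := pn; apply: nb.
- by have := pinj m k; rewrite mE xk => e; have := e _ _ erefl; lia.
Qed.

End Tree.

(** * Rank *)

Section SetRank.
Variable alpha : ordinal_type.

(** [set_rank e a A]: the graph induced by [e] on [A] has rank at most [a]. The
    components are replaced by arbitrary sets [B x] that contain them. *)
Inductive set_rank (V : Type) (e : V -> V -> Prop) : alpha -> set V -> Prop :=
  SetRank a A Z (g : V -> alpha) (B : V -> set V) :
    finite_set Z ->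
    (forall x, A x -> ~ Z x -> ord_lt (g x) a /\ B x x) ->
    (forall x, A x -> ~ Z x -> set_rank e (g x) (B x)) ->
    (forall x y z, A x -> ~ Z x -> B x y -> A y -> ~ Z y -> A z -> ~ Z z ->
       e y z -> B x z) ->
    set_rank e a A.

Lemma set_rankI (V : Type) (e : V -> V -> Prop) a A Z : finite_set Z ->
  (forall x, A x -> ~ Z x -> exists b B, [/\ ord_lt b a, B x, set_rank e b B &
     forall y z, B y -> A y -> ~ Z y -> A z -> ~ Z z -> e y z -> B z]) ->
  set_rank e a A.
Proof.
move=> Zfin h.
have /choice[gB gBP] : forall x, exists gB : alpha * set V, A x -> ~ Z x ->
    [/\ ord_lt gB.1 a, gB.2 x, set_rank e gB.1 gB.2 &
     forall y z, gB.2 y -> A y -> ~ Z y -> A z -> ~ Z z -> e y z -> gB.2 z].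
  move=> x; case: (pselect (A x /\ ~ Z x)) => [[Ax nZ]|nx].
    by have [b [B bBP]] := h x Ax nZ; exists (b, B).
  by exists (a, setT) => Ax nZ; case: nx.
apply: (@SetRank _ _ _ _ Z (fun x => (gB x).1) (fun x => (gB x).2)) => //.
- by move=> x Ax nZ; have [] := gBP x Ax nZ.
- by move=> x Ax nZ; have [] := gBP x Ax nZ.
- by move=> x y z Ax nZ; have [_ _ _ cl] := gBP x Ax nZ; apply: cl.
Qed.

Lemma set_rank_inv (V : Type) (e : V -> V -> Prop) a A : set_rank e a A ->
  exists Z (g : V -> alpha) (B : V -> set V),
  [/\ finite_set Z, forall x, A x -> ~ Z x -> ord_lt (g x) a /\ B x x,
      forall x, A x -> ~ Z x -> set_rank e (g x) (B x)
    & forall x y z, A x -> ~ Z x -> B x y -> A y -> ~ Z y -> A z -> ~ Z z ->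
        e y z -> B x z].
Proof. by case=> {a A} a A Z g B *; exists Z, g, B. Qed.

Lemma finite_preimage_inj_on (V W : Type) (f : V -> W) (A : set V) (Z : set W) :
  inj_on A f -> finite_set Z -> finite_set [set x | A x /\ Z (f x)].
Proof.
move=> fi; apply: card_le_finite; apply: (@inj_on_card_le _ _ _ _ f) => [x y|x] [] //.
by move=> Ax _ [Ay _]; apply: fi.
Qed.

(** The deleted set and the pieces are pulled back along [f]; injectivity keeps the deleted set
    finite. *)
Lemma set_rank_transport (V W : Type) (eV : V -> V -> Prop) (eW : W -> W -> Prop)
    (f : V -> W) (A : set V) (B : set W) a :
  set_rank eW a B -> (forall x, A x -> B (f x)) -> inj_on A f ->
  (forall x y, A x -> A y -> eV x y -> eW (f x) (f y)) -> set_rank eV a A.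
Proof.
move=> rB; elim: rB A => {a B} a B Z g C Zfin gP _ IH Ccl A AB finj fhom.
apply: (@set_rankI _ _ _ _ [set x | A x /\ Z (f x)]) => [|x Ax nZ].
  exact: finite_preimage_inj_on.
have nZx y : A y -> ~ [set x | A x /\ Z (f x)] y -> ~ Z (f y) by move=> Ay + Zy; apply.
have [gx Cx] := gP _ (AB _ Ax) (nZx _ Ax nZ).
exists (g (f x)), [set y | A y /\ C (f x) (f y)]; split=> //.
  apply: IH => [||y [] //|y z [Ay _] [Az _]|y z [Ay _] [Az _]] //; last exact: fhom.
  - exact: AB.
  - exact: nZx.
  - exact: finj.
move=> y z [_ Cy] Ay nZy Az nZz yz; split=> //.
apply: (Ccl _ (f y)) => //; by [apply: AB|apply: nZx|apply: fhom].
Qed.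

Lemma set_rank_sub (V : Type) (e : V -> V -> Prop) a (A B : set V) :
  set_rank e a B -> A `<=` B -> set_rank e a A.
Proof. by move=> rB AB; apply: (@set_rank_transport _ _ _ e id _ B). Qed.

(** Finitely many parts of rank at most [a] that are separated by a finite set do not raise the
    rank: delete [Z0] together with the finite sets that witness the ranks of the parts. *)
Lemma set_rank_glue (V I : Type) (e : V -> V -> Prop) a (A Z0 : set V)
    (D : set I) (P : I -> set V) :
  finite_set Z0 -> finite_set D -> (forall i, D i -> set_rank e a (P i)) ->
  (forall i x y, D i -> P i x -> ~ Z0 x -> A y -> ~ Z0 y -> e x y -> P i y) ->
  (forall x, A x -> ~ Z0 x -> (exists i, D i /\ P i x) \/
     exists b B, [/\ ord_lt b a, B x, set_rank e b B &
     forall y z, B y -> A y -> ~ Z0 y -> A z -> ~ Z0 z -> e y z -> B z]) ->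
  set_rank e a A.
Proof.
move=> Z0fin Dfin Prank Pcl h.
have /choice[Z ZP] : forall i, exists Z, D i -> finite_set Z /\
    forall x, P i x -> ~ Z x -> exists b B, [/\ ord_lt b a, B x, set_rank e b B &
      forall y z, B y -> P i y -> ~ Z y -> P i z -> ~ Z z -> e y z -> B z].
  move=> i; case: (pselect (D i)) => Di; last by exists set0.
  have [Z [g [B [Zfin gP BP Bcl]]]] := set_rank_inv (Prank _ Di); exists Z => _; split=> // x Px nZ.
  have [gx Bx] := gP x Px nZ; exists (g x), (B x); split=> //; first exact: BP.
  by move=> y z By Py nZy Pz nZz; apply: (Bcl x y z).
apply: (@set_rankI _ _ _ _ (Z0 `|` \bigcup_(i in D) Z i)).
  by rewrite finite_setU; split=> //; apply: bigcup_finite => // i /ZP[].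
move=> x Ax nx; have nZ0 y : ~ (Z0 `|` \bigcup_(i in D) Z i) y -> ~ Z0 y.
  by move=> ny Zy; apply: ny; left.
have nZi i y : D i -> ~ (Z0 `|` \bigcup_(i in D) Z i) y -> ~ Z i y.
  by move=> Di ny Zy; apply: ny; right; exists i.
have [[i [Di Px]]|[b [B [ba Bx rB Bcl]]]] := h x Ax (nZ0 _ nx); last first.
  by exists b, B; split=> // y z By Ay ny Az nz; apply: Bcl => //; apply: nZ0.
have [b [B [ba Bx rB Bcl]]] := (ZP _ Di).2 x Px (nZi _ _ Di nx).
exists b, (B `&` P i); split=> //; first exact: set_rank_sub rB (@subIsetl _ _ _).
move=> y z [By Py] Ay ny Az nz yz.
have Pz : P i z by apply: (Pcl i y) => //; apply: nZ0.
by split=> //; apply: (Bcl y) => //; apply: nZi.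
Qed.

Lemma has_rank_set_rank (a : alpha) (G : graph) :
  has_rank a G -> set_rank (@adj G) a [set: G].
Proof.
elim/(well_founded_ind (@ord_lt_wf alpha)): a G => a IH G /has_rankE.
case=> [[_ Gfin]|[_ _ [F [Ffin Fcomp]]]].
  by apply: (@set_rankI _ _ _ _ [set: G]) => // x _; case.
apply: (set_rankI Ffin) => x _ nx.
pose x' : delete F := exist _ x nx.
pose C := [set y | joined x' y].
have [b [ba /(IH _ ba) rC]] : exists b, ord_lt b a /\ has_rank b (induced C).
  by apply: Fcomp; exists x'.
have x'C : C x' by exact: joined_refl.
pose B := [set y | exists h : ~ sg_vertex F y, C (exist _ y h)].
have /choice[f fP] : forall y, exists c : induced C, B y -> sval (sval c) = y.
  move=> y; case: (pselect (B y)) => [[h Cy]|nB].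
    by exists (exist _ (exist _ y h) Cy).
  by exists (exist _ x' x'C).
exists b, B; split=> //; first by exists nx.
  apply: (set_rank_transport (f := f) rC) => // y z.
    by move=> /fP yE /fP zE e; rewrite -yE e zE.
  by move=> /fP yE /fP zE; rewrite /= yE zE.
move=> y z [h Cy] _ ny _ nz yz; exists nz.
by apply: joined_step Cy _.
Qed.

(** [has_rank] is exact, so one passes to the least bound, for [G] and again for each component; the
    least bound of a component still lies below that of [G]. *)
Lemma set_rank_has_rank (a : alpha) (G : graph) :
  set_rank (@adj G) a [set: G] -> rank_lt alpha G.
Proof.
move=> rG; have [b [{}rG bmin]] := wf_min (ex_intro (fun a => set_rank (@adj G) a setT) _ rG).
exists b; elim/(well_founded_ind (@ord_lt_wf alpha)): b G rG bmin {a} => a IH G rG amin.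
apply/has_rankE; case: (pselect (exists b : alpha, ord_lt b a)) => [exb|nb]; last first.
  left; split; first by move=> b ba; apply: nb; exists b.
  have [Z [g [B [Zfin gP _ _]]]] := set_rank_inv rG.
  apply: sub_finite_set Zfin => x _; apply: contrapT => nZ.
  by apply: nb; exists (g x); have [] := gP x I nZ.
right; split=> //; first by move=> [b [ba /has_rank_set_rank]]; apply: amin.
have [Z [g [B [Zfin gP BP Bcl]]]] := set_rank_inv rG.
pose F : subgraph G := @Subgraph G Z (fun _ _ => False) (fun _ _ h => h)
  (fun _ _ (h : False) => match h with end) (fun _ _ (h : False) => match h with end).
exists F; split=> // _ [[x nx] ->]; set C := [set y | _].
have [gx Bx] := gP x I nx.
have rC : set_rank (@adj (induced C)) (g x) [set: induced C].
  apply: (set_rank_transport (f := fun y : induced C => sval (sval y)) (BP x I nx)) => //.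
    move=> [[y ny] Cy] _ /=; apply: (@joined_closed (delete F) (fun y => B x (sval y)) _ _ Cy) => //.
    by move=> [u nu] [v nv] /= Bu uv; apply: (Bcl x u v).
  by move=> y z _ _ /sval_inj/sval_inj.
have [b [rb bmin]] := wf_min (ex_intro (fun a => set_rank _ a setT) _ rC).
have ba : ord_lt b a.
  have [h|[->|h]] := ord_lt_total b (g x) => //; last by case: (bmin _ h).
  exact: ord_lt_trans h gx.
by exists b; split=> //; apply: IH.
Qed.

(** * The rank of a tree of blocks *)

Inductive tree_rank (K : Type) : alpha -> tree K -> Prop :=
  TreeRank a t (X : set K) (g : K -> alpha) : finite_set X ->
    (forall i, ~ X i -> 0 < arity t i -> ord_lt (g i) a) ->
    (forall i j, ~ X i -> j < arity t i -> tree_rank (g i) (child t i j)) ->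
    (forall i j, X i -> j < arity t i -> tree_rank a (child t i j)) ->
    tree_rank a t.

Lemma tree_rank_mono (K : Type) (a b : alpha) (t : tree K) :
  tree_rank a t -> ord_lt a b -> tree_rank b t.
Proof.
elim=> {a t} a t X g Xfin ga gt _ _ IH ab.
apply: (TreeRank (X := X) (g := g)) => // [i nX n0|i j Xi ji].
  by apply: ord_lt_trans ab; apply: ga.
exact: IH.
Qed.

Lemma finite_addresses (K : Type) (D : set (K * nat)) :
  finite_set D -> finite_set [set x : address K | exists2 p, D p & x = [:: p]].
Proof.
move=> Dfin; suff -> : [set x : address K | exists2 p, D p & x = [:: p]] = (fun p => [:: p]) @` D.
  exact: finite_image.
by apply/seteqP; split=> [x [p Dp ->]|x [p Dp <-]]; exists p.
Qed.

Definition subtree_at (K : Type) (t : tree K) (p : K * nat) : set (address K) :=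
  [set x | exists2 y, in_tree (child t p.1 p.2) y & x = p :: y].

Lemma set_rank_subtree_at (K : Type) (t : tree K) p a :
  set_rank (tree_adj (child t p.1 p.2)) a (in_tree (child t p.1 p.2)) ->
  set_rank (tree_adj t) a (subtree_at t p).
Proof.
move=> r; apply: (set_rank_transport (f := behead) r).
- by move=> _ [y yin ->].
- by move=> _ _ [y _ ->] [z _ ->] /= ->.
- move=> _ _ [y _ ->] [z _ ->]; case: p {r} => i j /= [_ [[]//|[_ _]]]; by case; lia.
Qed.

Lemma set_rank_child (K : Type) (t : tree K) i j a (B : set (address K)) :
  set_rank (tree_adj t) a B -> (forall y, in_tree (child t i j) y -> B ((i, j) :: y)) ->
  set_rank (tree_adj (child t i j)) a (in_tree (child t i j)).
Proof.
move=> r h; apply: (set_rank_transport (f := cons (i, j)) r) => //.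
  by move=> x y _ _ [].
by move=> x y _ _ xy; split=> //; left.
Qed.

(** Deleting the finitely many vertices of the block itself separates the trees that hang at
    them. *)
Lemma set_rank_block (K : Type) (t : tree K) i a :
  (forall j, j < arity t i -> set_rank (tree_adj (child t i j)) a (in_tree (child t i j))) ->
  set_rank (tree_adj t) a [set x | in_tree t x /\ below [::] i x].
Proof.
move=> h; have Dfin : finite_set [set p : K * nat | p.1 = i /\ p.2 < arity t i].
  suff -> : [set p : K * nat | p.1 = i /\ p.2 < arity t i] = (fun j => (i, j)) @` `I_(arity t i).
    exact/finite_image/finite_II.
  by apply/seteqP; split=> [[k j] [/= -> ji]|_ [j ji <-]//]; exists j.
apply: (set_rank_glue (finite_addresses Dfin) Dfin (P := subtree_at t)).
- by move=> [k j] [/= -> ji]; apply: set_rank_subtree_at; apply: h.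
- move=> [k j] _ x [/= -> ji] [y yin ->] nx [xin [j' [w xE]]] nZ.
  rewrite xE in xin nZ * => /= -[_ [[jj' _]|[y0 _ _]]].
    by subst j'; case: xin => _ win; exists w.
  by case: nx; exists (i, j); rewrite ?y0.
- move=> x [xin [j [w xE]]] _; left; rewrite xE in xin *; case: xin => ji win.
  by exists (i, j); split=> //; exists w.
Qed.

(** Delete the root and the vertices of the exceptional blocks. The finitely many trees at these
    vertices are glued, and every other block at the root is separated together with all that hangs
    below it. *)
Lemma tree_rank_set_rank (K : Type) (a : alpha) (t : tree K) :
  tree_rank a t -> set_rank (tree_adj t) a (in_tree t).
Proof.
elim=> {a t} a t X g Xfin ga _ IHg _ IHX.
pose D := [set p : K * nat | X p.1 /\ p.2 < arity t p.1].
have Dfin : finite_set D.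
  suff -> : D = \bigcup_(i in X) ((fun j => (i, j)) @` `I_(arity t i)).
    by apply: bigcup_finite => // i _; exact/finite_image/finite_II.
  apply/seteqP; split=> [[i j] [/= Xi ji]|_ [i Xi [j ji <-]]//].
  by exists i => //; exists j.
apply: (set_rank_glue (Z0 := [set [::]] `|` _) _ Dfin (P := subtree_at t)).
- by rewrite finite_setU; split; [exact: finite_set1|exact: finite_addresses Dfin].
- by move=> [i j] [/= Xi ji]; apply: set_rank_subtree_at; apply: IHX.
- move=> [i j] _ [|[i' j'] x] [/= Xi ji] [y yin ->] nx; first by move=> _ []; left.
  move=> [_ xin] nZ [ii' [[jj' _]|[y0 _ _]]]; first by subst i' j'; exists x.
  by case: nx; right; exists (i, j); rewrite ?y0.
move=> [|[i j] x] [] ; first by move=> []; left.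
move=> ji xin nZ; case: (pselect (X i)) => Xi.
  by left; exists (i, j); split=> //; exists x.
right; exists (g i), [set x | in_tree t x /\ below [::] i x]; split.
- by apply: ga => //; apply: leq_ltn_trans ji.
- by split=> //; exists j, x.
- by apply: set_rank_block => k ki; apply: IHg.
- move=> _ [|[i' j'] z] [_ [k [w ->]]] _ _ zin nz; first by case: (nz (or_introl erefl)).
  by move=> /= [ii' _]; subst i'; split=> //; exists j', z.
Qed.

(** A block at the root is exceptional if the deleted set [Z] meets it or what hangs below it. Any
    other block, with all that hangs below it, is connected without the root and disjoint from [Z],
    so it lies in one piece of rank below [a]. The induction on [a] serves these blocks, and the
    induction on [t] the exceptional ones. *)
Lemma set_rank_tree_rank (K : Type) (a : alpha) (t : tree K) :
  set_rank (tree_adj t) a (in_tree t) -> tree_rank a t.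
Proof.
elim/(well_founded_ind (@ord_lt_wf alpha)): a t => a IHa t.
elim/tree_child_ind: t => t IHt rt.
have sub i j : j < arity t i -> set_rank (tree_adj (child t i j)) a (in_tree (child t i j)).
  by move=> ji; apply: (@set_rank_child _ t i j _ _ rt) => y yin; split.
have [Z [g [B [Zfin gP BP Bcl]]]] := set_rank_inv rt.
pose X := [set i | exists j x, Z ((i, j) :: x)].
have Xfin : finite_set X.
  have /choice[c cP] : forall i, exists x : address K, X i -> Z x /\ exists j y, x = (i, j) :: y.
    move=> i; case: (pselect (X i)) => [[j [x Zx]]|nX]; last by exists [::].
    by exists ((i, j) :: x) => _; split=> //; exists j, x.
  apply: card_le_finite Zfin; apply: (@inj_on_card_le _ _ _ _ c) => [i k|i /cP[]//].
  by move=> /cP[_ [j [y ->]]] /cP[_ [j' [y' ->]]] [].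
apply: (TreeRank (X := X) (g := fun i => g [:: (i, 0)])) => // [i nX n0|i j nX ji|i j _ ji].
- have [] // := gP [:: (i, 0)].
  by move=> Z0; apply: nX; exists 0, [::].
- have nZ k x : ~ Z ((i, k) :: x) by move=> Zx; apply: nX; exists k, x.
  have i0 : in_tree t [:: (i, 0)] by split=> //; apply: leq_ltn_trans ji.
  have [ga Bi0] := gP _ i0 (nZ _ _).
  apply: IHa => //; apply: (@set_rank_child _ t i j _ _ (BP _ i0 (nZ _ _))).
  (* Walk along the block from its first vertex, avoiding the root, which may have been deleted. *)
  have Bi k : k < arity t i -> B [:: (i, 0)] [:: (i, k)].
    elim: k => [//|k IHk] ki; have ki' := ltnW ki.
    by apply: (Bcl _ [:: (i, k)]) => //; [exact: IHk|split=> //; right; split=> //; left].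
  apply: (@tree_closed _ (child t i j) (fun y => B [:: (i, 0)] ((i, j) :: y))); first exact: Bi.
  move=> x y Bx xin yin xy; apply: (Bcl _ ((i, j) :: x)) => //.
  by split=> //; left.
- by apply: IHt => //; apply: sub.
Qed.

End SetRank.

(** * The tree of blocks of a graph *)

Section Representation.
Variables (T : eqType) (e : rel T).
Hypotheses (e_sym : symmetric e) (e_irr : irreflexive e).
Implicit Types (x y z u v w p : T) (s q P : seq T) (A B D : set T).

(** Unlike [joined], this is relative to a set and given by a list, so that cycles can be cut,
    reversed and rotated as sequences. *)
Definition walk A x y := exists s, [/\ path e x s, last x s = y & forall z, z \in x :: s -> A z].

Lemma split_mem x s : x \in s -> exists s1 s2, s = s1 ++ x :: s2.
Proof. by case/splitPr=> s1 s2; exists s1, s2. Qed.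

Lemma walk_refl A x : A x -> walk A x x.
Proof. by move=> Ax; exists [::]; split=> // z; rewrite inE => /eqP->. Qed.

Lemma walk_l A x y : walk A x y -> A x.
Proof. by move=> [s [_ _]]; apply; rewrite mem_head. Qed.

Lemma walk_r A x y : walk A x y -> A y.
Proof. by move=> [s [_ <-]]; apply; rewrite mem_last. Qed.

Lemma walk_trans A x y z : walk A x y -> walk A y z -> walk A x z.
Proof.
move=> [s [sp <- sA]] [s' [sp' <- sA']]; exists (s ++ s'); split.
- by rewrite cat_path sp.
- by rewrite last_cat.
- move=> w; rewrite -cat_cons mem_cat => /orP[|ws]; first exact: sA.
  by apply: sA'; rewrite inE ws orbT.
Qed.

Lemma walk_edge A x y : A x -> A y -> e x y -> walk A x y.
Proof.
move=> Ax Ay xy; exists [:: y]; split=> //=; first by rewrite xy.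
by move=> z; rewrite !inE => /orP[] /eqP->.
Qed.

Lemma walk_sym A x y : walk A x y -> walk A y x.
Proof.
move=> [s [+ + sA]]; elim: s x sA => [|z s IH] x sA /=.
  by move=> _ <-; apply: walk_refl; apply: sA; rewrite mem_head.
move=> /andP[xz zs] zy; apply: walk_trans (IH z _ zs zy) _.
  by move=> w ws; apply: sA; rewrite inE ws orbT.
by apply: walk_edge; rewrite 1?e_sym //; apply: sA; rewrite !inE eqxx ?orbT.
Qed.

Lemma walk_sub A B x y : walk A x y -> A `<=` B -> walk B x y.
Proof. by move=> [s [sp sl sA]] AB; exists s; split=> // z /sA /AB. Qed.

Lemma walk_uniq A x y : walk A x y -> exists s, [/\ path e x s, last x s = y,
  uniq (x :: s) & forall z, z \in x :: s -> A z].
Proof.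
move=> [s [sp <- sA]]; case: (shortenP sp) => s' sp' su sub; exists s'; split=> // z.
by rewrite inE => /predU1P[->|/sub zs]; apply: sA; rewrite inE ?eqxx ?zs ?orbT.
Qed.

Lemma walk_inside A x y : walk A x y -> walk (walk A x) x y.
Proof.
move=> [s [+ <- +]]; elim/last_ind: s => [|s z IH] sp sA.
  by apply: walk_refl; apply: walk_refl; apply: sA; rewrite mem_head.
have sA' w : w \in x :: s -> A w.
  by move=> ws; apply: sA; rewrite -rcons_cons mem_rcons inE ws orbT.
move: sp; rewrite rcons_path last_rcons => /andP[sp sz].
have Az : A z by apply: sA; rewrite -rcons_cons mem_rcons mem_head.
have ws : walk A x (last x s) by exists s.
have wz : walk A x z by apply: (walk_trans ws); apply: walk_edge sz => //; apply: (walk_r ws).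
by apply: walk_trans (IH sp sA') _; apply: walk_edge.
Qed.

Lemma walk_first A (Q : set T) x y : walk A x y -> ~ Q x -> Q y ->
  exists u v, [/\ walk (A `\` Q) x u, e u v, A v & Q v].
Proof.
move=> [s [+ + sA]]; elim: s x sA => [|z s IH] x sA /=; first by move=> _ <- nQ /nQ.
move=> /andP[xz zs] zy nQ Qy; case: (pselect (Q z)) => Qz.
  exists x, z; split=> //; last by apply: sA; rewrite !inE eqxx orbT.
  by apply: walk_refl; split=> //; apply: sA; rewrite mem_head.
have [|u [v [wu uv Av Qv]]] := IH z _ zs zy Qz Qy.
  by move=> w ws; apply: sA; rewrite inE ws orbT.
exists u, v; split=> //; apply: walk_trans wu; apply: walk_edge => //.
  by split=> //; apply: sA; rewrite mem_head.
by split=> //; apply: sA; rewrite !inE eqxx orbT.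
Qed.

Hypothesis no_even_cycle : forall c, uniq c -> 3 <= size c -> cycle e c -> odd (size c).

(** The three cycles of a theta graph cannot all be odd. *)
Lemma no_ear a b s1 s2 q : uniq (a :: s1 ++ b :: s2) -> cycle e (a :: s1 ++ b :: s2) ->
  3 <= size (a :: s1 ++ b :: s2) -> path e a (rcons q b) -> uniq q ->
  (forall z, z \in q -> z \notin a :: s1 ++ b :: s2) ->
  q <> [::] \/ s1 <> [::] /\ s2 <> [::] -> False.
Proof.
move=> cu cc c3 qp qu qn ne.
have o1 := no_even_cycle cu c3 cc.
have c3' : 3 <= size (a :: q ++ b :: s2) /\ 3 <= size (a :: s1 ++ b :: rev q).
  move: ne; rewrite /= !size_cat /= size_rev.
  by case: (q) => [|? ?]; case: (s1) => [|? ?]; case: (s2) => [|? ?] /=; try lia;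
    case=> // -[].
move: (cc); rewrite /= rcons_cat cat_path /= => /and3P[p1 p2 p3].
have cq : cycle e (a :: q ++ b :: s2).
  by rewrite /= rcons_cat -cat_rcons cat_path qp last_rcons.
have cr : cycle e (a :: s1 ++ b :: rev q).
  rewrite /= rcons_cat cat_path p1 /= p2 /=.
  have := rev_path e a (rcons q b); rewrite last_rcons belast_rcons rev_cons => ->.
  by rewrite (eq_path (e' := e)) // => u v; rewrite e_sym.
move: (cu); rewrite cons_uniq cat_uniq /= negb_or => /and3P[au u1 /and3P[/andP[bn1 n12] bn2 u2]].
move: au; rewrite mem_cat inE !negb_or => /and3P[an1 ab an2].
have qn' z : z \in q -> [/\ z != a, z \notin s1, z != b & z \notin s2].
  by move=> /qn; rewrite !inE mem_cat inE !negb_or => /and4P[].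
have aq : a \notin q by apply/negP => /qn'[]; rewrite eqxx.
have bq : b \notin q by apply/negP => /qn'[]; rewrite eqxx.
have o2 : odd (size (a :: q ++ b :: s2)).
  apply: no_even_cycle => //; last by have [] := c3'.
  rewrite /= mem_cat inE !negb_or aq ab an2 cat_uniq qu /= negb_or bq bn2 u2 /= andbT.
  by apply/hasPn => z zs; apply/negP => /qn'[_ _ _]; rewrite zs.
have o3 : odd (size (a :: s1 ++ b :: rev q)).
  apply: no_even_cycle => //; last by have [] := c3'.
  rewrite /= mem_cat inE !negb_or mem_rev aq ab an1 cat_uniq u1 /= negb_or bn1 mem_rev bq rev_uniq qu /= andbT.
  by apply/hasPn => z; rewrite mem_rev => /qn'[].
move: o1 o2 o3; rewrite /= !size_cat /= size_rev !addnS /= !oddD !negbK.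
by case: (odd (size s1)); case: (odd (size s2)); case: (odd (size q)).
Qed.

(** [P] lists in their order on the block the vertices of the block of [x] that
    leads into the component [D]; the last clause says that [P] has no chord and that
    every component of the rest of [D] hangs at a single vertex of [P]. *)
Definition block D x P : Prop :=
  [/\ [/\ uniq P, forall z, z \in P -> D z, path e x P & size P = 1 \/ ~~ odd (size P)],
      exists d P', P = d :: P',
      forall d z, z \in P -> D z -> e x z <-> z = head d P \/ z = last d P,
      forall z, D z -> e x z -> z \in P
    & (forall l1 l2 l3 y z, P = l1 ++ y :: l2 ++ z :: l3 -> e y z -> l2 = [::]) /\
      (forall y z w w', y \in P -> z \in P -> e y w -> e z w' ->
         walk [set v | D v /\ v \notin P] w w' -> y = z)].

(** If [x] has a single neighbour in [D], the block is an edge. Otherwise a path in [D] between two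
    neighbours closes up through [x] to a cycle. A further neighbour of [x], a chord, or a
    connection outside the cycle between two of its vertices would each be an ear, which [no_ear]
    excludes. *)
Lemma block_exists D x : ~ D x -> (exists d, D d /\ e x d) ->
  (forall y z, D y -> D z -> walk D y z) -> exists P, block D x P.
Proof.
move=> nDx [d [Dd xd]] Dconn.
case: (pselect (exists d', [/\ D d', e x d' & d' <> d])) => [[d' [Dd' xd' dd']]|nd]; last first.
  have nd' z : D z -> e x z -> z = d.
    by move=> Dz xz; apply: contrapT => zd; apply: nd; exists z.
  exists [:: d]; split=> //=.
  - by split=> //=; [move=> z; rewrite inE => /eqP->|rewrite xd|left].
  - by exists d, [::].
  - by move=> d1 z; rewrite inE => /eqP->; split; auto.
  - by move=> z Dz xz; rewrite inE; apply/eqP/nd'.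
  - split=> [l1 l2 l3 y z /(congr1 size)|y z w w']; last by rewrite !inE => /eqP-> /eqP->.
    by rewrite size_cat /= size_cat /=; lia.
have [s [sp sl su sD]] := walk_uniq (Dconn _ _ Dd Dd').
set P := d :: s in su sD.
have xP : x \notin P by apply/negP => /sD.
have cu : uniq (x :: P) by rewrite cons_uniq xP.
have s0 : 0 < size s by case: (s) sl => //= dd; case: dd'.
have cc : cycle e (x :: P).
  by rewrite /= rcons_path sp xd sl e_sym xd'.
have c3 : 3 <= size (x :: P) by rewrite /=; lia.
have Pev : ~~ odd (size P) by have := no_even_cycle cu c3 cc; rewrite /=.
have out z : D z -> z \notin P -> exists w p, [/\ walk [set v | D v /\ v \notin P] z w, p \in P & e w p].
  move=> Dz zP; have [||w [p [zw wp Dp Pp]]] := @walk_first D [set v | v \in P] z d (Dconn _ _ Dz Dd).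
  - by move/negP: zP.
  - by rewrite /= mem_head.
  - exists w, p; split=> //; apply: walk_sub zw _ => v [Dv /negP vP]; split=> //.
have nbr z : D z -> e x z -> z \in P.
  move=> Dz xz; apply/negPn/negP => zP; have [w [p [zw pP wp]]] := out z Dz zP.
  have [q [qp ql qu qD]] := walk_uniq zw.
  have [l1 [l2 E]] := split_mem pP.
  apply: (@no_ear x p l1 l2 (z :: q)); rewrite -?E //; last by left.
    by rewrite /= rcons_path xz qp ql wp.
  move=> v /qD[Dv vP]; rewrite inE negb_or vP andbT.
  by apply/eqP => vx; rewrite vx in Dv.
exists P; split.
- by split=> //; [rewrite /= xd|right].
- by exists d, s.
- move=> d1 z zP Dz; rewrite /P /= sl; split=> [xz|[->|->]] //.
  apply: contrapT => nz; have [l1 [l2 E]] := split_mem zP.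
  apply: (@no_ear x z l1 l2 [::]); rewrite -?E //=; first by rewrite xz.
  right; split=> l0; apply: nz; rewrite l0 in E.
    by left; case: E.
  by right; rewrite -sl; have := congr1 (last d) E; rewrite /= last_cat.
- exact: nbr.
(* [no_ear] expects one end of the ear at the head of the cycle, so the cycle is rotated to start at
   [y]. *)
have rot_cyc l1 y l2 z l3 : P = l1 ++ y :: l2 ++ z :: l3 ->
  [/\ uniq (y :: l2 ++ z :: l3 ++ x :: l1), cycle e (y :: l2 ++ z :: l3 ++ x :: l1) &
      forall v, (v \in y :: l2 ++ z :: l3 ++ x :: l1) = (v \in x :: P)].
  move=> E; have E' : y :: l2 ++ z :: l3 ++ x :: l1 = rot (size (x :: l1)) (x :: P).
    by rewrite E -cat_cons rot_size_cat /= -catA.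
  by rewrite E' rot_uniq rot_cycle; split=> // v; rewrite mem_rot.
have split2 y z : y \in P -> z \in P -> y <> z ->
    (exists l1 l2 l3, P = l1 ++ y :: l2 ++ z :: l3) \/ (exists l1 l2 l3, P = l1 ++ z :: l2 ++ y :: l3).
  move=> /split_mem[l1 [l2 E]] + yz.
  rewrite E mem_cat inE => /or3P[zl|/eqP zy|zl]; last 1 first.
  - by left; have [l3 [l4 E']] := split_mem zl; exists l1, l3, l4; rewrite E'.
  - by right; have [l3 [l4 E']] := split_mem zl; exists l3, l4, l2; rewrite E' -catA.
  - by case: yz.
split=> [l1 l2 l3 y z E yz|].
  have [u c m] := rot_cyc _ _ _ _ _ E.
  apply: contrapT => l20; apply: (@no_ear y z l2 (l3 ++ x :: l1) [::]) => //=.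
  - by rewrite /= size_cat /= size_cat /= !addnS.
  - by rewrite yz.
  - by right; split=> //; case: (l3).
move=> y z w w' yP zP yw zw' ww'.
have ear l1 y' l2 z' l3 v v' : P = l1 ++ y' :: l2 ++ z' :: l3 -> e y' v -> e z' v' ->
    walk [set v | D v /\ v \notin P] v v' -> False.
  move=> E yv zv /walk_uniq[q [qp ql qu qD]].
  have [u c m] := rot_cyc _ _ _ _ _ E.
  apply: (@no_ear y' z' l2 (l3 ++ x :: l1) (v :: q)) => //; last by left.
  - by rewrite /= size_cat /= size_cat /= !addnS.
  - by rewrite /= rcons_path yv qp ql e_sym zv.
  - move=> k /qD[Dk kP]; rewrite m inE negb_or kP andbT.
    by apply/eqP => kx; rewrite kx in Dk.
apply: contrapT => yz; have [[l1 [l2 [l3 E]]]|[l1 [l2 [l3 E]]]] := split2 y z yP zP yz.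
  exact: ear E yw zw' ww'.
exact: ear E zw' yw (walk_sym ww').
Qed.

Definition piece D P p : set T :=
  [set z | z = p \/ exists w, e p w /\ walk [set v | D v /\ v \notin P] w z].

Section Pieces.
Variables (D : set T) (x : T) (P : seq T).
Hypotheses (Dconn : forall y z, D y -> D z -> walk D y z) (blockP : block D x P).

Let rest := [set v | D v /\ v \notin P].

Lemma piece_sub p z : p \in P -> piece D P p z -> D z.
Proof.
have [[_ PD _ _] _ _ _ _] := blockP; move=> pP [->|[w [_ /walk_r[]//]]].
exact: PD.
Qed.

Lemma piece_on_block p z : z \in P -> piece D P p z -> z = p.
Proof. by move=> zP [//|[w [_ /walk_r[_]]]]; rewrite zP. Qed.

Lemma piece_connected p z : piece D P p z -> walk (piece D P p) p z.
Proof.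
move=> [->|[w [pw wz]]]; first by apply: walk_refl; left.
have sub : walk rest w `<=` piece D P p by move=> v wv; right; exists w.
apply: (walk_trans (walk_edge _ _ pw) (walk_sub (walk_inside wz) sub)); first by left.
by apply/sub/walk_refl/(walk_l wz).
Qed.

Lemma piece_cover z : D z -> exists p, p \in P /\ piece D P p z.
Proof.
have [[_ PD _ _] [d [P' PE]] _ _ _] := blockP => Dz.
case: (boolP (z \in P)) => zP; first by exists z; split=> //; left.
have dP : d \in P by rewrite PE mem_head.
have [|//|u [p [zu up Dp pP]]] := @walk_first D [set v | v \in P] z d (Dconn Dz (PD _ dP)).
  exact/negP.
exists p; split=> //; right; exists u; split; first by rewrite e_sym.
by apply/walk_sym/(walk_sub zu) => v [Dv /negP vP].
Qed.

Lemma piece_edge p p' u v : p \in P -> p' \in P -> piece D P p u -> piece D P p' v ->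
  p <> p' -> u <> v /\ (e u v -> u = p /\ v = p').
Proof.
have [_ _ _ _ [_ rigid]] := blockP => pP p'P pu p'v pp'.
case: pu => [->|[w [pw wu]]]; case: p'v => [->|[w' [pw' wv]]]; split=> //.
- by move=> E; have [_] := walk_r wv; rewrite -E pP.
- by move=> pv; case: pp'; apply: rigid pP p'P pv pw' (walk_sym wv).
- by move=> E; have [_] := walk_r wu; rewrite E p'P.
- move=> up'; case: pp'; apply: (rigid _ _ _ _ pP p'P pw _ wu); by rewrite e_sym.
- by move=> E; case: pp'; apply: rigid pP p'P pw pw' (walk_trans wu _); rewrite E; apply: walk_sym.
- move=> uv; case: pp'; apply: rigid pP p'P pw pw' (walk_trans wu _).
  by apply: walk_trans (walk_edge (walk_r wu) (walk_r wv) uv) (walk_sym wv).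
Qed.

Lemma block_path_edge i j : i < size P -> j < size P -> i <> j ->
  e (nth x P i) (nth x P j) <-> j = i.+1 \/ i = j.+1.
Proof.
have [[Pu _ Pp _] _ _ _ [chord _]] := blockP.
have step k : k.+1 < size P -> e (nth x P k) (nth x P k.+1).
  by move=> kP; have /pathP := Pp => /(_ x k.+1 kP).
have far k l : k < l -> l < size P -> e (nth x P k) (nth x P l) -> l = k.+1.
  move=> kl lP kle; pose l2 := take (l - k.+1) (drop k.+1 P).
  have E : P = take k P ++ nth x P k :: l2 ++ nth x P l :: drop l.+1 P.
    rewrite -{1}(cat_take_drop k P) (drop_nth x); last by lia.
    congr (_ ++ _ :: _); rewrite -{1}(cat_take_drop (l - k.+1) (drop k.+1 P)); congr (_ ++ _).
    by rewrite drop_drop subnK // (drop_nth x).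
  have := congr1 size (chord _ _ _ _ _ E kle); rewrite /l2 size_take size_drop /=; case: ifP; lia.
move=> iP jP ij; split=> [ije|[E|E]]; try subst.
- have [ij'|ji|//] := ltngtP i j; first by left; apply: far.
  by right; apply: far => //; rewrite e_sym.
- by apply: step; lia.
- by rewrite e_sym; apply: step; lia.
Qed.

End Pieces.

(** Each step down moves to an adjacent vertex and drops the old vertex from the set for good, so an
    infinite descent would trace a ray. *)
Definition pointed_lt (a b : set T * T) : Prop :=
  [/\ a.1 a.2, e b.2 a.2 & a.1 `<=` b.1 `\ b.2].

Hypothesis e_rayless : ~ exists r : nat -> T, injective r /\ forall i, e (r i) (r i.+1).

Lemma pointed_lt_wf : well_founded pointed_lt.
Proof.
move=> a0; apply: contrapT => na0; apply: e_rayless.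
have /choice[nxt nxtP] : forall a, exists b, ~ Acc pointed_lt a -> ~ Acc pointed_lt b /\ pointed_lt b a.
  move=> a; case: (pselect (Acc pointed_lt a)) => ha; first by exists a.
  apply: contrapT => nb; apply: ha; constructor=> b ba; apply: contrapT => hb.
  by apply: nb; exists b.
pose a n := iter n nxt a0.
have na n : ~ Acc pointed_lt (a n) by elim: n => [//|n IH]; have [] := nxtP _ IH.
have lt n : pointed_lt (a n.+1) (a n) by have [] := nxtP _ (na n).
have sub n d : (a (n + d)).1 `<=` (a n).1.
  elim: d => [|d IH]; rewrite ?addn0 // addnS => y.
  by have [_ _ h] := lt (n + d) => /h[/IH].
have ne n d : (a (n + d.+1)).2 <> (a n).2.
  have [_ _ h] := lt n; have [] := lt (n + d) => + _ _.
  by rewrite -addnS -addSnnS => /sub/h[].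
exists (fun n => (a n).2); split=> [i j ij|i]; last by have [] := lt i.
have [h|h|//] := ltngtP i j.
- by case: (ne i (j - i.+1)); rewrite ij; congr (a _).2; lia.
- by case: (ne j (i - j.+1)); rewrite -ij; congr (a _).2; lia.
Qed.

(** A vertex of a block through [x] need not be adjacent to [x]. It is reached by single steps along
    the block, and hence the recursion uses the transitive closure. *)
Lemma pointed_lt_path A B x p s : path e x (rcons s p) -> uniq (x :: rcons s p) ->
  (forall z, z \in rcons s p -> A z) -> B p -> B `<=` A ->
  (forall z, z \in x :: s -> ~ B z) ->
  clos_trans _ pointed_lt (B, p) (A, x).
Proof.
elim: s x A => [|y s IH] x A.
  move=> /= /andP[xp _] _ _ Bp BA Bx; apply: t_step; split=> // z Bz.
  by split; [exact: BA|move=> /= zx; apply: (Bx z) => //; rewrite zx mem_head].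
rewrite rcons_cons /= => /andP[xy sp] /and3P[xn yn su] As Bp BA Bx.
apply: (t_trans _ _ _ (A `\ x, y)); last first.
  apply: t_step; split=> //=; split; first by apply: As; rewrite mem_head.
  by move=> /= yx; move: xn; rewrite yx mem_head.
apply: IH => //=; first by rewrite yn.
- move=> z zs; split; first by apply: As; rewrite inE zs orbT.
  by move=> /= zx; move: xn; rewrite -zx inE zs orbT.
- move=> z Bz; split; first exact: BA.
  by move=> /= zx; apply: (Bx z) => //; rewrite zx mem_head.
- by move=> z zs; apply: Bx; rewrite inE zs orbT.
Qed.

Variables (K : Type) (eK : T -> K).
Hypothesis eK_inj : injective eK.

Definition represents A x (t : tree K) (r : address K -> T) : Prop :=
  [/\ r [::] = x /\ (forall a, in_tree t a -> A (r a)),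
      forall a b, in_tree t a -> in_tree t b -> r a = r b -> a = b,
      forall y, A y -> exists a, in_tree t a /\ r a = y
    & forall a b, in_tree t a -> in_tree t b -> (tree_adj t a b <-> e (r a) (r b))].

(** The blocks through [x] correspond to the components of [A] without [x]. Each is indexed by the
    code under [eK] of a chosen vertex of its component, and the recursion goes into the pieces at
    the vertices of the block. *)
Lemma exists_represents A x : A x -> (forall y, A y -> walk A x y) ->
  exists t r, represents A x t r.
Proof.
suff: forall c : set T * T, c.1 c.2 -> (forall y, c.1 y -> walk c.1 c.2 y) ->
    exists t r, represents c.1 c.2 t r by move=> h; apply: (h (A, x)).
clear A x; elim/(well_founded_ind (wf_clos_trans _ _ pointed_lt_wf)) => -[A x] IH /= Ax Aconn.
(* The choice depends on the set alone, so all vertices of a component yield the same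
   representative. *)
have /choice[pick pickP] : forall Q : set T, exists y, (exists z, Q z) -> Q y.
  by move=> Q; case: (pselect (exists z, Q z)) => [[z Qz]|nQ]; [exists z|exists x].
pose D y := walk (A `\ x) y.
have Dsym y z : D y z -> D z y by apply: walk_sym.
have Deq y z : D y z -> D y = D z.
  move=> yz; apply/seteqP; split=> w; last exact: walk_trans.
  exact: (walk_trans (Dsym _ _ yz)).
have Drefl y : A y -> y <> x -> D y y by move=> Ay yx; apply: walk_refl.
have DA y z : D y z -> A z /\ z <> x by move=> /walk_r[].
pose root k y := [/\ A y, y <> x, eK y = k & pick (D y) = y].
have Dconn y z w : D y z -> D y w -> walk (D y) z w.
  move=> yz yw; have := Deq _ _ yz => E; rewrite E in yw *.
  exact: walk_inside yw.
have root_block y : A y -> y <> x -> exists P, block (D y) x P.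
  move=> Ay yx; apply: block_exists; [by move=> /DA[]| |by move=> z w; apply: Dconn].
  have [s [sp sl su sA]] := walk_uniq (Aconn _ Ay).
  case: s sp sl su sA => [|d s] /= => [_ xy|/andP[xd sp] sl /andP[xs su] sA]; first by case: yx.
  exists d; split=> //; apply: Dsym; exists s; split=> // z zs; split.
    by apply: sA; rewrite inE zs orbT.
  by move=> /= zx; move: xs; rewrite -zx zs.
(* For each index: the block, then the trees and the maps of its pieces. An index that codes no
   representative gets the empty list, so its arity is 0. *)
have /choice[F FP] : forall k, exists F : seq T * ((nat -> tree K) * (nat -> address K -> T)),
    (forall y, root k y -> block (D y) x F.1 /\
      forall j, j < size F.1 -> represents (piece (D y) F.1 (nth x F.1 j)) (nth x F.1 j) (F.2.1 j) (F.2.2 j)) /\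
    ((forall y, ~ root k y) -> F.1 = [::]).
  move=> k; case: (pselect (exists y, root k y)) => [[y ky]|nk]; last first.
    exists ([::], (fun _ => Leaf, fun _ _ => x)); split=> // y ky.
    by case: nk; exists y.
  have [Ay yx yk yr] := ky; have [P PB] := root_block _ Ay yx.
  have [[Pu PD Pp _] _ _ _ _] := PB.
  have Dy z w : D y z -> D y w -> walk (D y) z w by apply: Dconn.
  have /choice[tr trP] : forall j, exists tr : tree K * (address K -> T), j < size P ->
      represents (piece (D y) P (nth x P j)) (nth x P j) tr.1 tr.2.
    move=> j; case: (ltnP j (size P)) => jP; last by exists (Leaf, fun _ => x).
    have pP : nth x P j \in P by apply: mem_nth.
    have [|||t [r tr]] := IH (piece (D y) P (nth x P j), nth x P j).
    - have E : P = rcons (take j P) (nth x P j) ++ drop j.+1 P.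
        by rewrite -take_nth // cat_take_drop.
      apply: (pointed_lt_path (s := take j P)).
      + by move: Pp; rewrite {1}E cat_path => /andP[].
      + rewrite -rcons_cons; move: Pu; rewrite {1}E cat_uniq => /andP[Pu _].
        rewrite rcons_cons cons_uniq Pu andbT.
        by apply/negP => xP; case: (DA y x) => //; apply: PD; rewrite E mem_cat xP.
      + by move=> z zs; case: (DA y z) => //; apply: PD; rewrite E mem_cat zs.
      + by left.
      + by move=> z /(piece_sub PB pP)/DA[].
      + move=> z; rewrite inE => /predU1P[->|zs zp]; first by move=> /(piece_sub PB pP)/DA[].
        have zP : z \in P by rewrite E mem_cat mem_rcons inE zs orbT.
        move: Pu; rewrite {1}E cat_uniq rcons_uniq -(piece_on_block zP zp) zs.
        by [].
    - by left.
    - by move=> z; apply: piece_connected.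
    - by exists (t, r).
  exists (P, (fun j => (tr j).1, fun j => (tr j).2)); split=> [y' [_ _ y'k _]|nr].
    have -> : y' = y by apply: eK_inj; rewrite y'k.
    by split=> // j; apply: trP.
  by case: (nr y).
pose P k := (F k).1; pose f k j := (F k).2.1 j; pose r k j := (F k).2.2 j.
have rootP k j : j < size (P k) -> exists y, [/\ root k y, block (D y) x (P k) &
    represents (piece (D y) (P k) (nth x (P k) j)) (nth x (P k) j) (f k j) (r k j)].
  move=> jP; case: (pselect (exists y, root k y)) => [[y ky]|nk]; last first.
    have [_ h] := FP k; move: jP; rewrite /P h // => y ky.
    by apply: nk; exists y.
  by have [/(_ _ ky)[Pb h] _] := FP k; exists y; split=> //; apply: h.
pose t := Node (fun k => size (P k)) f.
(* A block from [block] has size 1 or even size, so [block_size] does not reset it to 0. *)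
have ar k : arity t k = size (P k).
  rewrite /= /block_size; case: ifP => // /negbT; rewrite negb_or negbK => /andP[P1 Podd].
  have [|y [_ [[_ _ _ h] _ _ _ _] _]] := rootP k 0; first by case: (P k) Podd.
  by case: h => [h|]; [rewrite h in P1|rewrite Podd].
have tE k j a : in_tree t ((k, j) :: a) = (j < size (P k) /\ in_tree (f k j) a).
  by rewrite -ar.
exists t, (fun a => if a is (k, j) :: a' then r k j a' else x).
have rD k j a y : j < size (P k) -> in_tree (f k j) a -> root k y -> D y (r k j a).
  move=> jP ain [_ _ yk _]; have [y' [[_ _ y'k _] Pb [[_ h] _ _ _]]] := rootP _ _ jP.
  have -> : y = y' by apply: eK_inj; rewrite yk.
  by apply: (piece_sub Pb) (h _ ain); apply: mem_nth.
have same_root k k' y y' : root k y -> root k' y' -> D y = D y' -> k = k'.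
  by move=> [_ _ <- yr] [_ _ <- y'r] E; rewrite -yr -y'r E.
split.
- split=> // -[|[k j] a] //; rewrite tE => -[jP ain].
  have [y [ky _ _]] := rootP _ _ jP.
  by have /DA[] := rD _ _ _ _ jP ain ky.
- move=> [|[k j] a] [|[k' j'] b] //; rewrite ?tE.
  + move=> _ [jP ain] E; have [y [ky _ _]] := rootP _ _ jP.
    by have /DA[_] := rD _ _ _ _ jP ain ky; rewrite -E.
  + move=> [jP ain] _ E; have [y [ky _ _]] := rootP _ _ jP.
    by have /DA[_] := rD _ _ _ _ jP ain ky; rewrite E.
  move=> [jP ain] [jP' bin] E.
  have [y [ky Pb [[_ rin] rinj _ _]]] := rootP _ _ jP.
  have [y' [ky' _ _]] := rootP _ _ jP'.
  have kk : k = k'.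
    apply: (same_root _ _ y y') => //.
    rewrite (Deq _ _ (rD _ _ _ _ jP ain ky)) (Deq _ _ (rD _ _ _ _ jP' bin ky')).
    by rewrite E.
  subst k'; have yy : y' = y.
    by apply: eK_inj; have [_ _ -> _] := ky; have [_ _ -> _] := ky'.
  subst y'; have jj : j = j'.
    have [y' [[_ _ y'k _] _ [[_ rin'] _ _ _]]] := rootP _ _ jP'.
    have yy : y' = y by case: ky => _ _ yk _; apply: eK_inj; rewrite yk.
    subst y'; apply: contrapT => jj.
    have [[Pu _ _ _] _ _ _ _] := Pb.
    have pp : nth x (P k) j <> nth x (P k) j' by move=> /eqP; rewrite nth_uniq // => /eqP.
    have [] := piece_edge Pb (mem_nth x jP) (mem_nth x jP') (rin _ ain) (rin' _ bin) pp.
    by rewrite E.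
  by subst j'; rewrite (rinj _ _ ain bin E).
- move=> y Ay; case: (pselect (y = x)) => [->|yx]; first by exists [::].
  pose y0 := pick (D y); have y0y : D y y0 by apply: pickP; exists y; apply: Drefl.
  have Dy0 := Deq _ _ y0y.
  have ky0 : root (eK y0) y0.
    by have [Ay0 y0x] := DA _ _ y0y; split=> //; rewrite -Dy0.
  have [/(_ _ ky0)[Pb h] _] := FP (eK y0).
  have [p [pP py]] : exists p, p \in P (eK y0) /\ piece (D y0) (P (eK y0)) p y.
    by apply: (piece_cover _ Pb); [move=> z w; apply: Dconn|rewrite -Dy0; apply: Drefl].
  have jP : index p (P (eK y0)) < size (P (eK y0)) by rewrite index_mem.
  have := h _ jP; rewrite nth_index // => -[_ _ /(_ _ py)[a [ain ay]] _].
  exists ((eK y0, index p (P (eK y0))) :: a); split=> //.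
  by rewrite tE.
have xadj k j a : j < size (P k) -> in_tree (f k j) a ->
    e x (r k j a) <-> a = [::] /\ (j = 0 \/ j.+1 = size (P k)).
  move=> jP ain; have [y [ky Pb [[r0 rin] rinj _ _]]] := rootP _ _ jP.
  have [[Pu PD _ _] [d [P' PE]] ends nbr _] := Pb.
  have pP : nth x (P k) j \in P k by apply: mem_nth.
  have ends' : e x (nth x (P k) j) <-> j = 0 \/ j.+1 = size (P k).
    have P0 : 0 < size (P k) by apply: leq_ltn_trans jP.
    rewrite (ends x _ pP (PD _ pP)) -nth0 -nth_last.
    have nthE i : i < size (P k) -> nth x (P k) j = nth x (P k) i <-> j = i.
      by move=> iP; split=> [/eqP|->] //; rewrite nth_uniq // => /eqP.
    have := nthE 0 P0; have := nthE (size (P k)).-1 _.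
    rewrite -ltnS prednK // => /(_ (ltnSn _)) h1 h2.
    split=> [[/h2|/h1 ->]|[/h2|h]]; [by left|by right; rewrite prednK|by left|].
    by right; apply/h1; rewrite -h.
  split=> [xr|[-> /ends']]; last by rewrite r0.
  have rP : r k j a \in P k by apply: nbr xr; apply: rD ky.
  have rE := piece_on_block rP (rin _ ain).
  split; last by apply/ends'; rewrite -rE.
  by apply: rinj => //; rewrite r0.
move=> [|[k j] a] [|[k' j'] b]; rewrite ?tE.
- by move=> _ _; split=> //; rewrite e_irr.
- by move=> _ [jP bin]; rewrite xadj // -ar.
- move=> [jP ain] _; rewrite e_sym xadj // -ar /=.
  by split=> -[-> [->|h]]; split=> //; auto.
move=> [jP ain] [jP' bin].
have [y [ky Pb [[r0 rin] _ _ radj]]] := rootP _ _ jP.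
have [y' [ky' Pb' [[r0' rin'] _ _ _]]] := rootP _ _ jP'.
case: (pselect (k = k')) => [kk|kk]; last first.
  split=> [[]//|ab]; case: kk; apply: (same_root _ _ y y') => //.
  have Da := rD _ _ _ _ jP ain ky; have Db := rD _ _ _ _ jP' bin ky'.
  rewrite (Deq _ _ Da) (Deq _ _ Db); apply: Deq; apply: walk_edge ab.
    exact: walk_r Da.
  exact: walk_r Db.
subst k'; have yy : y' = y.
  by apply: eK_inj; have [_ _ -> _] := ky; have [_ _ -> _] := ky'.
subst y'; case: (pselect (j = j')) => [jj|jj].
  subst j'; split=> [[_ [[_ /radj h]|[_ _ []]]]|ab]; rewrite ?h //; try by lia.
  by split=> //; left; split=> //; apply/radj.
have [[Pu _ _ _] _ _ _ _] := Pb.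
have pp : nth x (P k) j <> nth x (P k) j' by move=> /eqP; rewrite nth_uniq // => /eqP.
have [_ pe] := piece_edge Pb (mem_nth x jP) (mem_nth x jP') (rin _ ain) (rin' _ bin) pp.
have be := block_path_edge Pb jP jP' jj.
split=> [[_ [[]//|[-> -> h]]]|ab].
  by rewrite r0 r0'; apply/be.
split=> //; right; have [ra rb] := pe ab.
have [_ [_ _ [_ rinj _ _]]] := rootP _ _ jP; have [_ [_ _ [_ rinj' _ _]]] := rootP _ _ jP'.
split; [by apply: rinj => //; rewrite r0|by apply: rinj' => //; rewrite r0'|].
by apply/be; rewrite -ra -rb.
Qed.

End Representation.

(** * Universal trees *)

Lemma card_le_decode X K (D : set X) : inhabited K -> D #<= [set: K] ->
  exists (f : X -> K) (g : K -> option X),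
    (forall x, D x -> g (f x) = Some x) /\ (forall k x, g k = Some x -> D x /\ f x = k).
Proof.
move=> [k0] /(card_le_inj_on k0)[f [finj _]].
have /choice[g gP] : forall k, exists o : option X,
    (forall x, o = Some x -> D x /\ f x = k) /\ (o = None -> forall x, D x -> f x <> k).
  move=> k; case: (pselect (exists x, D x /\ f x = k)) => [[x [Dx xk]]|nx].
    by exists (Some x); split=> // y [<-].
  by exists None; split=> // _ x Dx xk; apply: nx; exists x.
exists f, g; split=> [x Dx|k x]; last by have [h _] := gP k; apply: h.
case E: (g (f x)) => [y|]; last by have [_ /(_ E x Dx)] := gP (f x).
by have [/(_ y E)[Dy fy] _] := gP (f x); rewrite (finj _ _ Dy Dx fy).
Qed.

Lemma embeds_inv K (t u : tree K) : embeds t u -> exists s : K -> K,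
  [/\ forall i i', 0 < arity t i -> 0 < arity t i' -> s i = s i' -> i = i',
      forall i, 0 < arity t i -> arity u (s i) = arity t i
    & forall i j, j < arity t i -> embeds (child t i j) (child u (s i) j)].
Proof. by case=> {t u} t u s *; exists s. Qed.

Lemma tree_graph_rank_lt (alpha : ordinal_type) K (t : tree K) (a : alpha) :
  tree_rank a t -> rank_lt alpha (tree_graph t).
Proof.
move=> /tree_rank_set_rank rt; apply: (@set_rank_has_rank _ a).
apply: (set_rank_transport (f := fun x : tree_graph t => sval x) rt) => //.
  by move=> x _; apply: svalP.
by move=> x y _ _ /sval_inj.
Qed.

(** [SCons a b] is read in two ways: as the finite tree [a] with a further block [b] at
    its root, and as the list of finite trees (along a block) with head [a] and tail
    [b]. *)
Inductive skeleton := SNil | SCons (a b : skeleton).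

Fixpoint skeleton_code (s : skeleton) : GenTree.tree nat :=
  if s is SCons a b then GenTree.Node 0 [:: skeleton_code a; skeleton_code b]
  else GenTree.Leaf 0.

Lemma skeleton_code_inj : injective skeleton_code.
Proof. by elim=> [|a IHa b IHb] [|a' b'] //= [/IHa -> /IHb ->]. Qed.

Fixpoint skeleton_size (s : skeleton) : nat :=
  if s is SCons _ b then (skeleton_size b).+1 else 0.

Fixpoint skeleton_of m (s : nat -> skeleton) : skeleton :=
  if m is m'.+1 then SCons (s 0) (skeleton_of m' (fun j => s j.+1)) else SNil.

Lemma skeleton_size_of m s : skeleton_size (skeleton_of m s) = m.
Proof. by elim: m s => //= m IH s; rewrite IH. Qed.

Section Universal.
Variables (K : Type) (K_infinite : infinite_set [set: K]).

Lemma card_le_skeleton (A : set skeleton) : A #<= [set: K].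
Proof.
apply: (@card_le_trans _ _ _ [set: GenTree.tree nat]); last exact: countable_card_le.
by apply: (@inj_on_card_le _ _ _ _ skeleton_code) => // x y _ _ /skeleton_code_inj.
Qed.

Lemma block_size_arity (t : tree K) i : block_size (arity t i) = arity t i.
Proof. by rewrite /block_size; case: (arityP t i) => [->|->] //; rewrite orbT. Qed.

Variables (emb : option K -> K) (dec : K -> option (option K)).
Hypotheses (embK : forall o, dec (emb o) = Some o)
  (decK : forall k o, dec k = Some o -> emb o = k).

(** Hilbert's hotel: the old block [i] moves to the index [emb (Some i)], and the new block takes
    [emb None]. *)
Definition add_block (t : tree K) m (c : nat -> tree K) : tree K :=
  Node (fun k => match dec k with Some (Some i) => arity t i | Some None => m | None => 0 end)
       (fun k j => match dec k with Some (Some i) => child t i j | _ => c j end).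

(** The two components follow the two readings of a skeleton and are computed together because each
    calls on the other. Every vertex of the finite tree receives a copy of [t]. *)
Fixpoint grow (t : tree K) (s : skeleton) : tree K * (nat -> tree K) :=
  if s is SCons a b then
    (add_block (grow t a).1 (skeleton_size b) (grow t b).2,
     fun j => if j is j'.+1 then (grow t b).2 j' else (grow t a).1)
  else (t, fun _ => Leaf).

Lemma grow_skeleton_of t m s j : j < m -> (grow t (skeleton_of m s)).2 j = (grow t (s j)).1.
Proof. by elim: m s j => //= m IH s [|j] jm //; rewrite IH. Qed.

(** The new block simply joins the finite set of exceptional ones. *)
Lemma tree_rank_add_block (alpha : ordinal_type) (a : alpha) t m c :
  tree_rank a t -> (forall j, j < m -> tree_rank a (c j)) ->
  tree_rank a (add_block t m c).
Proof.
case=> {a t} a t X g Xfin ga gt Xt ct.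
pose X' := emb @` (None |` (Some @` X)).
have X'fin : finite_set X'.
  by apply: finite_image; rewrite finite_setU; split; [exact: finite_set1|exact: finite_image].
apply: (TreeRank (X := X') (g := fun k => if dec k is Some (Some i) then g i else a)) => //.
- move=> k nX /=; case E: (dec k) => [[i|]|] //=.
    rewrite block_size_arity; apply: ga => Xi; apply: nX; exists (Some i); last exact: decK.
    by right; exists i.
  by case: nX; exists None; [left|exact: decK].
- move=> k j nX /=; case E: (dec k) => [[i|]|] //=.
    rewrite block_size_arity; apply: gt => Xi; apply: nX; exists (Some i); last exact: decK.
    by right; exists i.
  by case: nX; exists None; [left|exact: decK].
- move=> _ j [o + <-] /=; rewrite embK => -[->|[i Xi <-]].
    by move=> jm; apply: ct; move: jm; rewrite /block_size; case: ifP.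
  by rewrite block_size_arity; apply: Xt.
Qed.

Lemma tree_rank_grow (alpha : ordinal_type) (a : alpha) t s : tree_rank a t ->
  tree_rank a (grow t s).1 /\ forall j, j < skeleton_size s -> tree_rank a ((grow t s).2 j).
Proof.
move=> rt; elim: s => [//|b [IHb _] c [_ IHc]] /=.
by split=> [|[|j] jc] //; [apply: tree_rank_add_block|apply: IHc].
Qed.

Variables (alpha : ordinal_type).
Hypothesis segments : forall a : alpha, [set b | ord_lt b a] #<= [set: K].

Definition universal_base (a : alpha) (u : tree K) : Prop :=
  tree_rank a u /\ forall t : tree K, tree_rank a t -> exists s, embeds t (grow u s).1.

Lemma exists_universal_base (a : alpha) : exists u, universal_base a u.
Proof.
elim/(well_founded_ind (@ord_lt_wf alpha)): a => a IH.
have [k0] := infinite_inhabited K_infinite.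
have /choice[u uP] : forall b : alpha, exists u, ord_lt b a -> universal_base b u.
  move=> b; case: (pselect (ord_lt b a)) => ba; last by exists Leaf.
  by have [u uP] := IH b ba; exists u.
(* The last coordinate numbers the copies: block [i] of a given tree will take copy [i], which makes
   the map on blocks injective. *)
pose D := [set x : alpha * skeleton * K | ord_lt x.1.1 a].
have DK : D #<= [set: K].
  have -> : D = ([set b | ord_lt b a] `*` [set: skeleton]) `*` [set: K].
    by apply/seteqP; split=> x //= [[]].
  by do 2?[apply: card_le_prod => //]; exact: card_le_skeleton.
have [f [g [fK gK]]] := card_le_decode (infinite_inhabited K_infinite) DK.
pose base := Node (fun k => if g k is Some (b, l, _) then skeleton_size l else 0)
  (fun k j => if g k is Some (b, l, _) then (grow (u b) l).2 j else Leaf).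
have arity_f b l c : ord_lt b a -> arity base (f (b, l, c)) = block_size (skeleton_size l).
  by move=> ba; rewrite /= fK.
have child_f b l c j : ord_lt b a -> child base (f (b, l, c)) j = (grow (u b) l).2 j.
  by move=> ba; rewrite /= fK.
exists base; split.
  apply: (TreeRank (X := set0) (g := fun k => if g k is Some (b, _, _) then b else a)) => //.
  - by move=> k _ /=; case E: (g k) => [[[b l] c]|] //; have [] := gK _ _ E.
  - move=> k j _ /=; case E: (g k) => [[[b l] c]|] // jl; have [ba _] := gK _ _ E.
    apply: (tree_rank_grow l (uP b ba).1).2.
    by move: jl; rewrite /block_size; case: ifP.
suff: forall a' t, tree_rank a' t -> a' = a -> exists s, embeds t (grow base s).1.
  by move=> hr t /hr; apply.
move=> a' t; elim=> {a' t} a' t X h Xfin ha ht _ _ IHX aE; subst a'.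
have {}IHX i j : X i -> j < arity t i -> exists s, embeds (child t i j) (grow base s).1.
  by move=> Xi ji; apply: IHX.
have {ht} ht i j : ~ X i -> j < arity t i -> exists s, embeds (child t i j) (grow (u (h i)) s).1.
  move=> nX ji; apply: (uP (h i) _).2; last exact: ht.
  by apply: ha => //; apply: leq_ltn_trans ji.
have [xs XE] := (finite_seqP (X : set {classic K})).1 Xfin.
move: XE IHX ha ht; move: (X) => {Xfin} Y.
(* Induction on the list of exceptional blocks at the root. With none left, the tree embeds into
   [base] itself, each block going to the copy with its own rank bound and its own list of
   skeletons. *)
elim: xs t Y => [|x xs IHxs] t Y -> hX ha ht.
  have /choice[s sP] : forall ij : K * nat, exists s, ij.2 < arity t ij.1 ->
      embeds (child t ij.1 ij.2) (grow (u (h ij.1)) s).1.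
    move=> [i j]; case: (ltnP j (arity t i)) => ji; last by exists SNil => /=; lia.
    have nX : ~ [set` ([::] : seq {classic K})] i by [].
    by have [s sP] := ht i j nX ji; exists s.
  exists SNil; have h' i : 0 < arity t i -> ord_lt (h i) a by move=> i0; apply: ha.
  apply: (@Embeds _ _ _ (fun i => f (h i, skeleton_of (arity t i) (fun j => s (i, j)), i))).
  - move=> i i' i0 i'0 /(congr1 g); rewrite !fK; [|exact: h'|exact: h'].
    by case.
  - by move=> i i0; rewrite arity_f ?skeleton_size_of ?block_size_arity //; apply: h'.
  - move=> i j ji; have i0 := leq_ltn_trans (leq0n j) ji.
    by rewrite child_f ?grow_skeleton_of //; [apply: (sP (i, j))|apply: h'].
have /choice[s sP] : forall j, exists s, j < arity t x ->
    embeds (child t x j) (grow base s).1.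
  move=> j; case: (ltnP j (arity t x)) => ji; last by exists SNil => /=; lia.
  have xX : [set` x :: xs] x by rewrite /= mem_head.
  by have [s sP] := hX x j xX ji; exists s.
(* The exceptional block [x] is removed by giving it size 0; [SCons] then adds it to the skeleton
   obtained for the rest. *)
pose t' : tree K := Node (fun i : K => if (i : {classic K}) == x then 0 else arity t i) (child t).
have ar' i : arity t' i = if (i : {classic K}) == x then 0 else arity t i.
  by rewrite /=; case: eqP => _; rewrite ?block_size_arity.
have [||||s' emb'] := IHxs t' [set` xs].
- by [].
- move=> i j ixs; rewrite ar'; case: eqP => // _ ji; apply: hX => //.
  by rewrite /= inE (ixs : is_true _) orbT.
- move=> i ixs; rewrite ar'; case: eqP => // /eqP ix; apply: ha => /=.
  by rewrite inE (negbTE ix).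
- move=> i j ixs; rewrite ar'; case: eqP => // /eqP ix; apply: ht => /=.
  by rewrite inE (negbTE ix).
exists (SCons s' (skeleton_of (arity t x) s)).
have [r [rinj rar rch]] := embeds_inv emb'.
pose r' (i : K) := if (i : {classic K}) == x then emb None else emb (Some (r i)).
have emb_inj o o' : emb o = emb o' -> o = o' by move=> /(congr1 dec); rewrite !embK => -[].
apply: (@Embeds _ _ _ r').
- move=> i i' i0 i'0; rewrite /r'; case: eqP => [->|ix]; case: eqP => [->|i'x] // /emb_inj //.
  by case; apply: rinj; rewrite ar'; case: eqP.
- move=> i i0; rewrite /r' /=; case: eqP => [->|ix]; rewrite embK.
    by rewrite skeleton_size_of block_size_arity.
  by rewrite block_size_arity rar ar'; case: eqP.
- move=> i j ji; rewrite /r' /=; case: eqP => [ix|ix]; rewrite embK.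
    by subst i; rewrite grow_skeleton_of //; apply: sP.
  by apply: rch; rewrite ar'; case: eqP.
Qed.

End Universal.

(** * From graphs to trees of blocks *)

Section GraphTree.
Variables (K : Type) (G : graph).

Let e : rel {classic G} := fun x y => `[< @adj G x y >].

Lemma avoiding_no_even_cycle (c : seq {classic G}) : avoiding K even_cycles G ->
  uniq c -> 3 <= size c -> cycle e c -> odd (size c).
Proof.
move=> [_ noC] cu c3 cc; apply: contrapT => /negP ceven.
apply: (noC (cycle_graph (size c))); first by exists (size c).
case: c cu c3 cc ceven => // x0 c cu c3 cc ceven; set n := size (x0 :: c).
have step (i : nat) : i < n -> @adj G (nth x0 (x0 :: c) i) (nth x0 (x0 :: c) (i.+1 %% n)).
  move=> i_n; have := elimT (pathP x0) cc i; rewrite size_rcons => /(_ i_n) /asboolP.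
  rewrite -rcons_cons nth_rcons i_n.
  suff -> : nth x0 (rcons c x0) i = nth x0 (x0 :: c) (i.+1 %% n) by [].
  have [i_n'|i_n'] := ltnP i.+1 n.
    by rewrite modn_small //= nth_rcons -ltnS -/n i_n'.
  have iE : i.+1 = n by apply/eqP; rewrite eqn_leq i_n i_n'.
  by rewrite iE modnn nth_rcons; case: iE => ->; rewrite ltnn eqxx.
pose f (i : cycle_graph n) : G := nth x0 (x0 :: c) (sval i).
have finj : injective f.
  move=> [i i_n] [j j_n] ij; apply: sval_inj; apply/eqP.
  by rewrite -(nth_uniq x0 i_n j_n cu); apply/eqP.
have fadj (i j : cycle_graph n) : adj i j -> adj (f i) (f j).
  case: i j => [i i_n] [j j_n] [_ /= [E|E]]; rewrite /f /= E; first exact: step.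
  by apply: adj_sym; apply: step.
exact: (inhabits (Immersion finj fadj)).
Qed.

Definition graph_represents (x : G) (t : tree K) (r : address K -> G) : Prop :=
  [/\ r [::] = x,
      forall a b, in_tree t a -> in_tree t b -> r a = r b -> a = b,
      forall y : G, exists a, in_tree t a /\ r a = y
    & forall a b, in_tree t a -> in_tree t b -> (tree_adj t a b <-> adj (r a) (r b))].

Lemma exists_graph_represents (x : G) : infinite_set [set: K] ->
  avoiding K even_cycles G -> exists t r, graph_represents x t r.
Proof.
move=> Kinf GA; have [[[_ Gconn] Grl GK] _] := GA.
have [k0] := infinite_inhabited Kinf.
have [eK [eKinj _]] := card_le_inj_on k0 GK.
have esym : symmetric e.
  by move=> u v; apply/asboolP/asboolP; apply: adj_sym.
have eirr : irreflexive e by move=> u; apply/asboolP; apply: adj_irrefl.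
have erl : ~ exists r : nat -> {classic G}, injective r /\ forall i, e (r i) (r i.+1).
  by move=> [r [rinj radj]]; apply: Grl; exists r; split=> // i; apply/asboolP/radj.
have eKinj' : injective (eK : {classic G} -> K) by move=> u v; apply: eKinj.
have [//|y _|t [r [[r0 _] rinj rsurj radj]]] :=
    @exists_represents _ e esym eirr (fun c => avoiding_no_even_cycle GA) erl K eK eKinj'
      [set: {classic G}] (x : {classic G}).
  apply: (@joined_closed G (fun z => walk e setT x z) _ _ (Gconn x y)).
    exact: walk_refl.
  by move=> u v xu uv; apply: (walk_trans xu); apply: walk_edge => //; apply/asboolP.
exists t, r; split=> // [y|a b ain bin]; first exact: rsurj.
by rewrite radj //; split=> [/asboolP|h]; [|apply/asboolP].
Qed.

Lemma represents_tree_rank (alpha : ordinal_type) (x : G) t r :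
  graph_represents x t r -> rank_lt alpha G -> exists a : alpha, tree_rank a t.
Proof.
move=> [_ rinj _ radj] [a /has_rank_set_rank ra]; exists a.
apply: set_rank_tree_rank; apply: (set_rank_transport (f := r) ra) => //.
by move=> u v uin vin /radj; apply.
Qed.

Lemma represents_immersion (x : G) t r u : graph_represents x t r -> embeds t u ->
  exists Phi : strong_immersion G (tree_graph u),
    forall L, has_open_ear (image_subgraph Phi L) -> has_open_ear L.
Proof.
move=> [_ rinj rsurj radj] /embeds_embedding[h [_ hE hcl]].
have [hin hinj hadj] := hE.
have /choice[s sP] := rsurj.
have sin y : in_tree t (s y) by have [] := sP y.
have rs y : r (s y) = y by have [] := sP y.
pose f (y : G) : tree_graph u := exist _ (h (s y)) (hin _ (sin y)).
have finj : injective f.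
  by move=> y z /(congr1 (@sval _ _)) /= /hinj E; rewrite -(rs y) E ?rs.
have fadj y z : adj y z <-> adj (f y) (f z).
  by rewrite /= -(hadj _ _ (sin y) (sin z)) radj // !rs.
pose Phi := @StrongImmersion G (tree_graph u)
  (@Immersion G (tree_graph u) f finj (fun y z => (fadj y z).1)) fadj.
exists Phi => L [n [p [n0 [pinj padj] [[y0 Ly0 p0] [yn Lyn pn]] pout pedge]]].
have pim k : k <= n -> exists y, f y = p k.
  have hp y m : f y = p m -> (h @` in_tree t) (sval (p m)).
    by move=> <-; exists (s y).
  move=> kn; have [|||||a ain ak] := @block_closed_path _ t u h (fun k => sval (p k)) n hE hcl _ _ _ _ _ k kn.
  - by move=> i j iN jN /sval_inj; apply: pinj.
  - by move=> i _; apply: svalP.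
  - by move=> i iN; apply: padj.
  - exact: hp p0.
  - exact: hp pn.
  exists (r a); apply: sval_inj => /=; rewrite -ak; congr h.
  by apply: rinj => //; rewrite rs.
have /choice[q qP] : forall k, exists y, k <= n -> f y = p k.
  move=> k; case: (leqP k n) => kn; last by exists x.
  by have [y yk] := pim k kn; exists y.
have in_L k : k <= n -> sg_vertex L (q k) -> sg_vertex (image_subgraph Phi L) (p k).
  by move=> kn Lq; exists (q k) => //; apply: qP.
exists n, q; split=> //.
- split=> [i j iN jN qij|i iN]; first by apply: pinj => //; rewrite -!qP // qij.
  by apply/fadj; rewrite !qP //; [apply: padj|apply: ltnW].
- have -> : q 0 = y0 by apply: (finj); rewrite qP.
  by have -> : q n = yn by apply: (finj); rewrite qP.
- by move=> i i0 iN /(in_L _ (ltnW iN)); apply: pout.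
- move=> i iN Lq; apply: (pedge i iN); exists (q i), (q i.+1); split=> //.
    by apply: qP; apply: ltnW.
  exact: qP.
Qed.

End GraphTree.

(** * The universal families and their cardinality *)

Section Main.
Variables (K : Type) (K_infinite : infinite_set [set: K]).

Lemma exists_option_code : exists (emb : option K -> K) (dec : K -> option (option K)),
  (forall o, dec (emb o) = Some o) /\ (forall k o, dec k = Some o -> emb o = k).
Proof.
have h : [set: option K] #<= [set: K].
  have [k0] := infinite_inhabited K_infinite.
  apply: (@card_le_trans _ _ _ [set: bool * K]); last first.
    by apply: card_le_setT_prod => //; apply: countable_card_le.
  apply: (@inj_on_card_le _ _ _ _ (fun o => if o is Some k then (true, k) else (false, k0))) => //.
  by move=> [k|] [k'|] _ _ //= [->].
have [f [g [fK gK]]] := card_le_decode (infinite_inhabited K_infinite) h.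
by exists f, g; split=> [o|k o /gK[]//]; apply: fK.
Qed.

Lemma universal_family (alpha : ordinal_type) :
  (forall a : alpha, [set b | ord_lt b a] #<= [set: K]) ->
  exists u : alpha -> skeleton -> tree K, (forall a s, tree_rank a (u a s)) /\
    forall a t, tree_rank a t -> exists s, embeds t (u a s).
Proof.
move=> seg; have [emb [dec [embK decK]]] := exists_option_code.
have /choice[b bP] := @exists_universal_base K K_infinite emb dec embK decK alpha seg.
exists (fun a s => (grow dec (b a) s).1); split=> a; last by have [_] := bP a.
by move=> s; have [rb _] := bP a; have [] := tree_rank_grow embK decK s rb.
Qed.

Lemma bounded_rank_universal (alpha : ordinal_type) : ord_lt_successor alpha K ->
  exists F : set graph,
    [/\ F `<=` avoiding_rank K alpha even_cycles,
        forall (G : graph) (L : subgraph G),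
          avoiding_rank K alpha even_cycles G -> finite_subgraph L ->
          exists H : graph, F H /\
          exists Phi : strong_immersion G H,
            ~ has_open_ear L -> ~ has_open_ear (image_subgraph Phi L)
      & F #<= [set: K]].
Proof.
move=> aK; have seg (a : alpha) : [set b | ord_lt b a] #<= [set: K].
  exact: card_le_trans (card_leT _) aK.
have [u [ur uE]] := universal_family seg.
exists ((fun p : alpha * skeleton => tree_graph (u p.1 p.2)) @` [set: alpha * skeleton]); split.
- move=> _ [[a s] _ <-] /=; split; first exact: tree_graph_avoiding.
  exact: tree_graph_rank_lt (ur a s).
- move=> G L [GA Grk] _; have [[[[x _] _] _ _] _] := GA.
  have [t [r tr]] := exists_graph_represents x K_infinite GA.
  have [a ta] := represents_tree_rank tr Grk; have [s ts] := uE a t ta.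
  exists (tree_graph (u a s)); split; first by exists (a, s).
  by have [Phi PhiP] := represents_immersion tr ts; exists Phi => nL /PhiP.
- apply: card_le_trans (card_image_le _ _) _.
  by apply: card_le_setT_prod => //; apply: card_le_skeleton.
Qed.

(** A graph that contains every member of [F] at each of its vertices, joined to
    a new vertex [v], does not embed into a member [H] of [F]: an embedding maps [v]
    to some [w], and applying it to the copy of [H] that is joined to [v] at [w], then
    iterating, yields a ray from [w]. *)
Lemma strongly_universal_not_small (F : set graph) :
  strongly_universal (avoiding K even_cycles) F -> ~ (F #<= [set: K]).
Proof.
move=> [FA Funiv] FK; pose D := [set x : {H : graph & H} | F (projT1 x)].
have DK : D #<= [set: K].
  apply: (@card_le_trans _ _ _ (\bigcup_(H in F) ((fun v : H => existT _ H v) @` [set: H]))).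
    by apply: subset_card_le => -[H v] FH; exists H => //; exists v.
  apply: card_le_bigcup => // H FH; apply: card_le_trans (card_image_le _ _) _.
  by have [[_ _ ->]] := FA H FH.
have [f [g [fK gK]]] := card_le_decode (infinite_inhabited K_infinite) DK.
have /choice[T TP] : forall x : {H : graph & H}, exists t : tree K, D x ->
    exists r, graph_represents (projT2 x) t r.
  move=> x; case: (pselect (D x)) => Dx; last by exists Leaf.
  by have [t [r tr]] := exists_graph_represents (projT2 x) K_infinite (FA _ Dx); exists t => _; exists r.
pose t := Node (fun k => if g k is Some _ then 1 else 0)
               (fun k _ => if g k is Some x then T x else Leaf).
have [H [FH [Phi]]] := Funiv _ (tree_graph_avoiding t K_infinite).
pose root : tree_graph t := exist _ [::] I.
pose w := Phi root; pose x : {H : graph & H} := existT _ H w.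
have Dx : D x by [].
have [r [r0 rinj rsurj radj]] := TP x Dx.
have /choice[s sP] := rsurj.
have tin y : in_tree t ((f x, 0) :: s y).
  by split; rewrite /= fK //; have [] := sP y.
pose psi (y : H) : H := Phi (exist _ ((f x, 0) :: s y) (tin y) : tree_graph t).
have psi_inj : injective psi.
  move=> y z /im_inj /(congr1 (@sval _ _)) /= [] E.
  by have [_ <-] := sP y; have [_ <-] := sP z; rewrite E.
have psi_w y : psi y <> w by move=> /im_inj /(congr1 (@sval _ _)).
have psi_adj y z : adj y z -> adj (psi y) (psi z).
  move=> yz; apply: (@im_adj _ _ Phi) => /=; split=> //; left; split=> //.
  rewrite fK //; have [yin ry] := sP y; have [zin rz] := sP z.
  by apply/radj; rewrite ?ry ?rz.
have w_psi : adj w (psi w).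
  apply: (@im_adj _ _ Phi) => /=; split; last by left.
  by have [win rw] := sP w; apply: rinj => //; rewrite r0 rw.
have [[_ Hrl _] _] := FA H FH; apply: Hrl.
(* The orbit of [w] does not repeat, because [psi] is injective and misses [w]. *)
have it n m : iter n psi w = iter (n + m) psi w -> m = 0.
  elim: n => [|n IH]; last by rewrite addSn /= => /psi_inj.
  by case: m => // m /= /esym/psi_w.
exists (fun n => iter n psi w); split=> [i j ij|n]; last first.
  by elim: n => [|n IH] //=; apply: psi_adj.
have [h|h|//] := ltngtP i j.
  by have := it i (j - i); rewrite subnKC ?(ltnW h) // => /(_ ij); lia.
by have := it j (i - j); rewrite subnKC ?(ltnW h) // => /(_ (esym ij)); lia.
Qed.

(** By regularity the ranks of the at most [K] children have a common bound [b] in [S], so any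
    larger [c] bounds the rank of [t] with no exceptional block at the root. *)
Lemma tree_rank_successor (S : ordinal_type) (t : tree K) :
  (forall a : S, [set b | ord_lt b a] #<= [set: K]) -> ~ ([set: S] #<= [set: K]) ->
  exists a : S, tree_rank a t.
Proof.
move=> seg SK; have [s0 _] : exists s : S, True.
  apply: contrapT => nS; apply: SK; suff -> : [set: S] = set0 by exact: card_ge0.
  by apply/seteqP; split=> // s _; apply: nS; exists s.
elim/tree_child_ind: t => t IH.
have /choice[a aP] : forall ij : K * nat, exists a : S,
    ij.2 < arity t ij.1 -> tree_rank a (child t ij.1 ij.2).
  move=> [i j]; case: (ltnP j (arity t i)) => ji; last by exists s0 => /=; lia.
  by have [a ta] := IH i j ji; exists a.
have KN : [set: K * nat] #<= [set: K].
  by apply: card_le_setT_prod => //; apply: countable_card_le.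
have [b ab] := ord_lt_bounded K_infinite a seg SK KN.
(* Applied to a constant map, this only says that [S] has an element above [b]. *)
have [c bc] := ord_lt_bounded K_infinite (fun _ : K => b) seg SK (card_lexx _).
have [k0] := infinite_inhabited K_infinite.
exists c; apply: (TreeRank (X := set0) (g := fun _ => b)) => //.
  by move=> i _ _; apply: (bc k0).
by move=> i j _ ji; apply: tree_rank_mono (aP (i, j) ji) (ab _ I).
Qed.

Lemma avoiding_Stc : exists kappa_plus : Type, is_successor_cardinal K kappa_plus /\
  is_Stc (avoiding K even_cycles) kappa_plus.
Proof.
have [S [seg SK Smin]] := exists_successor K_infinite.
have KS : [set: K] #<= [set: S] by case: (card_le_total [set: K] [set: S]).
have S_infinite : infinite_set [set: S].
  by apply/infiniteP; apply: card_le_trans KS; apply/infiniteP.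
exists S; split; first by split=> [|T [KT TK]]; [split|apply: Smin].
have lower F : strongly_universal (avoiding K even_cycles) F -> [set: S] #<= F.
  by move=> /strongly_universal_not_small; apply: Smin.
split=> //; have [u [ur uE]] := universal_family seg.
pose F := (fun p : S * skeleton => tree_graph (u p.1 p.2)) @` [set: S * skeleton].
have Funiv : strongly_universal (avoiding K even_cycles) F.
  split=> [_ [p _ <-]|G GA]; first exact: tree_graph_avoiding.
  have [[[[x _] _] _ _] _] := GA.
  have [t [r tr]] := exists_graph_represents x K_infinite GA.
  have [a ta] := tree_rank_successor t seg SK; have [s ts] := uE a t ta.
  exists (tree_graph (u a s)); split; first by exists (a, s).
  by have [Phi _] := represents_immersion tr ts; exists.
exists F; split=> //; rewrite card_eq_le lower // andbT.
apply: card_le_trans (card_image_le _ _) _.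
by apply: card_le_setT_prod => //; apply: card_le_skeleton.
Qed.

End Main.

Theorem theorem7p4 (K : Type) (K_infinite : infinite_set [set: K]) :
  (forall alpha : ordinal_type, ord_lt_successor alpha K -> ord_nonzero alpha ->
     exists F : set graph,
       [/\ F `<=` avoiding_rank K alpha even_cycles,
           forall (G : graph) (L : subgraph G),
             avoiding_rank K alpha even_cycles G -> finite_subgraph L ->
             exists H : graph, F H /\
             exists Phi : strong_immersion G H,
               ~ has_open_ear L -> ~ has_open_ear (image_subgraph Phi L)
         & F #<= [set: K]]) /\
  (exists kappa_plus : Type, is_successor_cardinal K kappa_plus /\
     is_Stc (avoiding K even_cycles) kappa_plus).
Proof.
split; last exact: avoiding_Stc.
by move=> alpha aK _; apply: bounded_rank_universal.
Qed.
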